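(* Let $P$ be a (finite) tree. Then, for almost all trees $T$, the quantum automorphism group $\mathrm{Aut}^{+}(T)$ contains $\mathrm{Aut}^{+}(P)$ as a quantum subgroup. That is, the proportion, among the $n^{n-2}$ labelled trees $T$ on $n$ vertices, of those for which $\mathrm{Aut}^{+}(P)$ is a quantum subgroup of $\mathrm{Aut}^{+}(T)$ tends to $1$ as $n\to+\infty$.
   Context: Graphs are finite, undirected and without loops (and without multiple edges); a tree is a connected graph without cycles. ''Almost all trees'' (or ''almost surely'') refers to the uniform probability measure on the set of labelled trees with vertex set $\{1,\dots,n\}$: a property holds for almost all trees if its probability tends to $1$ as $n\to+\infty$. For a finite graph $G$ with $m$ vertices and adjacency matrix $A_G$, the quantum automorphism group $\mathrm{Aut}^{+}(G)$ (in the sense of Banica) is the compact quantum group whose full C*-algebra $C(\mathrm{Aut}^{+}(G))$ is the universal unital C*-algebra generated by elements $u_{xy}$ ($x,y\in V(G)$) subject to the relations: each $u_{xy}$ is a projection ($u_{xy}=u_{xy}^*=u_{xy}^2$), $\sum_{y}u_{xy}=1=\sum_{y}u_{yx}$ for all $x$, and $uA_G=A_Gu$ where $u=(u_{xy})$; the comultiplication is $\Delta(u_{xy})=\sum_z u_{xz}\otimes u_{zy}$. A compact quantum group $\mathbb{H}$ is a quantum subgroup of $\mathbb{G}$ if there is a surjective unital $*$-homomorphism $\pi:C(\mathbb{G})\to C(\mathbb{H})$ between the full C*-algebras such that $\Delta_{\mathbb{H}}\circ\pi=(\pi\otimes\pi)\circ\Delta_{\mathbb{G}}$. *)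

(* Defs.v *)
From HB Require Import structures.
From mathcomp Require Import all_boot all_order all_algebra.
From mathcomp Require Import all_classical all_reals all_analysis.
From mathcomp Require Import complex.

Set Implicit Arguments.
Unset Strict Implicit.
Unset Printing Implicit Defensive.

Import Order.TTheory GRing.Theory Num.Theory.
Import numFieldNormedType.Exports.

Local Open Scope ring_scope.

(* Unital C*-algebras.  The library provides no structure of normed algebra, and
   a join of its algebras with its normed modules is not accepted by the
   hierarchy, so the norm and its completeness are stated over GRing.Algebra.
   The underlying ring is nontrivial (1 != 0), which excludes only the zero
   algebra. *)
HB.mixin Record isCStarAlgebra (R : realType) A of GRing.Algebra R[i] A := {
  cnorm : A -> R;
  cnorm_eq0 : forall a : A, cnorm a = 0 -> a = 0;
  cnormD : forall a b : A, cnorm (a + b) <= cnorm a + cnorm b;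
  cnormZ : forall (z : R[i]) (a : A), (cnorm (z *: a))%:C%C = `|z| * (cnorm a)%:C%C;
  cnormM : forall a b : A, cnorm (a * b) <= cnorm a * cnorm b;
  cnorm_complete : forall a : nat -> A,
    (forall eps : R, 0 < eps -> exists N : nat, forall m n : nat,
       (N <= m)%N -> (N <= n)%N -> cnorm (a m - a n) < eps) ->
    exists l : A, forall eps : R, 0 < eps -> exists N : nat, forall n : nat,
       (N <= n)%N -> cnorm (a n - l) < eps;
  star : A -> A;
  starK : forall a : A, star (star a) = a;
  starD : forall a b : A, star (a + b) = star a + star b;
  starZ : forall (z : R[i]) (a : A), star (z *: a) = Num.conj z *: star a;
  starM : forall a b : A, star (a * b) = star b * star a;
  cstar_identity : forall a : A, cnorm (star a * a) = cnorm a ^+ 2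
}.

#[short(type="cstarType")]
HB.structure Definition CStarAlgebra (R : realType) :=
  {A of GRing.Algebra R[i] A & isCStarAlgebra R A}.

(* Unital *-homomorphisms. *)
Record star_hom (R : realType) (A B : cstarType R) := StarHom {
  star_hom_fun :> {lrmorphism A -> B};
  star_hom_star : forall a : A, star_hom_fun (star a) = star (star_hom_fun a)
}.

HB.mixin Record isHilbert (R : realType) H of CompleteNormedModule R[i] H := {
  dot : H -> H -> R[i];
  dot_linearl : forall (z : R[i]) (x y w : H),
    dot (z *: x + y) w = z * dot x w + dot y w;
  dot_conj : forall x y : H, dot y x = Num.conj (dot x y);
  dot_norm : forall x : H, dot x x = `|x| ^+ 2
}.

#[short(type="hilbertType")]
HB.structure Definition Hilbert (R : realType) :=
  {H of CompleteNormedModule R[i] H & isHilbert R H}.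

(* Unital *-representations of A by bounded operators on H. *)
Record representation (R : realType) (A : cstarType R) (H : hilbertType R) :=
  Representation {
  rep_fun :> A -> {linear H -> H};
  rep_bounded : forall a : A, continuous (rep_fun a);
  rep_linear : forall (z : R[i]) (a b : A) (x : H),
    rep_fun (z *: a + b) x = z *: rep_fun a x + rep_fun b x;
  rep_one : forall x : H, rep_fun 1 x = x;
  rep_mul : forall (a b : A) (x : H), rep_fun (a * b) x = rep_fun a (rep_fun b x);
  rep_star : forall (a : A) (x y : H),
    dot (rep_fun (star a) x) y = dot x (rep_fun a y)
}.

(* A list s of pairs (h, k) encodes the vector sum_s h (x) k of the algebraic
   tensor product of H and K, a dense subspace of the Hilbert space tensor
   product; this is the square of its norm. *)
Definition tensor_sqnorm (R : realType) (H K : hilbertType R)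
    (s : seq (H * K)) : R[i] :=
  \sum_(p <- s) \sum_(q <- s) dot p.1 q.1 * dot p.2 q.2.

Definition tensor_act (R : realType) (A B : cstarType R) (H K : hilbertType R)
    (rho : representation A H) (sigma : representation B K)
    (t : seq (A * B)) (s : seq (H * K)) : seq (H * K) :=
  [seq (rho p.1 q.1, sigma p.2 q.2) | p <- t, q <- s].

(* The spatial norm of sum_t a (x) b is the supremum, over all representations
   rho of A and sigma of B, of the operator norm of sum_t rho a (x) sigma b
   (the supremum is attained when rho and sigma are faithful).  This predicate
   says that it is at most c. *)
Definition spatial_norm_le (R : realType) (A B : cstarType R)
    (t : seq (A * B)) (c : R) : Prop :=
  forall (H K : hilbertType R)
         (rho : representation A H) (sigma : representation B K)
         (s : seq (H * K)),
    tensor_sqnorm (tensor_act rho sigma t s) <= (c ^+ 2)%:C%C * tensor_sqnorm s.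

(* The minimal (spatial) C*-tensor product of A and B, unique up to
   isomorphism: a C*-algebra with commuting copies of A and B, in which the
   elements sum_t a (x) b are dense and carry the spatial norm. *)
Record min_tensor (R : realType) (A B : cstarType R) := MinTensor {
  tensor_alg :> cstarType R;
  tensor_inl : star_hom A tensor_alg;
  tensor_inr : star_hom B tensor_alg;
  tensor_comm : forall (a : A) (b : B),
    tensor_inl a * tensor_inr b = tensor_inr b * tensor_inl a;
  tensor_dense : forall (d : tensor_alg) (eps : R), 0 < eps ->
    exists t : seq (A * B),
      cnorm (d - \sum_(p <- t) tensor_inl p.1 * tensor_inr p.2) < eps;
  tensor_norm : forall (t : seq (A * B)) (c : R), 0 <= c ->
    cnorm (\sum_(p <- t) tensor_inl p.1 * tensor_inr p.2) <= c
    <-> spatial_norm_le t c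
}.

Definition tensor (R : realType) (A B : cstarType R) (D : min_tensor A B)
    (a : A) (b : B) : D :=
  tensor_inl D a * tensor_inr D b.

(* C(G) together with its comultiplication C(G) -> C(G) (x) C(G).
   Coassociativity and cancellation are not recorded: they hold automatically
   for quantum automorphism groups, and are not used in the notion of quantum
   subgroup. *)
Record qgroup (R : realType) := QGroup {
  qalg : cstarType R;
  qtensor : min_tensor qalg qalg;
  qcomult : star_hom qalg qtensor
}.

Definition quantum_subgroup (R : realType) (H G : qgroup R) : Prop :=
  exists (p : star_hom (qalg G) (qalg H))
         (pp : star_hom (qtensor G) (qtensor H)),
  [/\ forall b : qalg H, exists a : qalg G, p a = b,
      forall a b : qalg G,
        pp (tensor (qtensor G) a b) = tensor (qtensor H) (p a) (p b) &
      forall a : qalg G, qcomult H (p a) = pp (qcomult G a)].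

(* The defining relations of C(Aut+(e)); the last one is u A = A u, where A is
   the adjacency matrix of e. *)
Definition qaut_relations (R : realType) (V : finType) (e : rel V)
    (A : cstarType R) (u : V -> V -> A) : Prop :=
  [/\ forall x y, u x y = star (u x y) /\ u x y = u x y ^+ 2,
      forall x, \sum_y u x y = 1 /\ \sum_y u y x = 1 &
      forall x y, \sum_z u x z * (e z y)%:R = \sum_z (e x z)%:R * u z y].

Definition qaut_universal (R : realType) (V : finType) (e : rel V)
    (A : cstarType R) (u : V -> V -> A) : Prop :=
  qaut_relations e u /\
  forall (B : cstarType R) (v : V -> V -> B), qaut_relations e v ->
    (exists f : star_hom A B, forall x y, f (u x y) = v x y) /\
    (forall f g : star_hom A B,
       (forall x y, f (u x y) = v x y) -> (forall x y, g (u x y) = v x y) ->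
       f =1 g).

(* G is the quantum automorphism group of the graph e; this determines G up to
   isomorphism. *)
Definition is_qaut (R : realType) (V : finType) (e : rel V)
    (G : qgroup R) : Prop :=
  exists u : V -> V -> qalg G, qaut_universal e u /\
    forall x y, qcomult G (u x y) = \sum_z tensor (qtensor G) (u x z) (u z y).

Definition qaut_subgroup (R : realType) (V W : finType)
    (e : rel V) (f : rel W) : Prop :=
  forall H G : qgroup R, is_qaut e H -> is_qaut f G -> quantum_subgroup H G.

(* Trees.  For a symmetric relation a closed walk x, y, x along an edge is a
   ucycle of size 2, so graph cycles are the ucycles of size at least 3. *)
Definition simple_graph (V : finType) (e : rel V) : Prop :=
  symmetric e /\ irreflexive e.

Definition is_tree (V : finType) (e : rel V) : Prop :=
  [/\ simple_graph e,
      (0 < #|V|)%N /\ (forall x y : V, connect e x y) &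
      forall c : seq V, ucycle e c -> (size c < 3)%N].

(* Adjacency functions on {0, ..., n-1}, i.e. candidate labelled graphs. *)
Definition labelled_rel (n : nat) := {ffun 'I_n * 'I_n -> bool}.

Definition rel_of (n : nat) (t : labelled_rel n) : rel 'I_n :=
  fun x y => t (x, y).

Definition labelled_trees (n : nat) : {set labelled_rel n} :=
  [set t : labelled_rel n | `[< is_tree (rel_of t) >]].

Definition tree_proportion (R : realType)
    (Q : forall n : nat, rel 'I_n -> Prop) (n : nat) : R :=
  #|[set t in labelled_trees n | `[< Q n (rel_of t) >]]|%:R
  / #|labelled_trees n|%:R.

Definition almost_all_trees (R : realType)
    (Q : forall n : nat, rel 'I_n -> Prop) : Prop :=
  (tree_proportion R Q n @[n --> \oo] --> (1 : R))%classic.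

(* Main.v *)
From HB Require Import structures.
Require Import Defs.
From mathcomp Require Import all_boot all_order all_algebra.
From mathcomp Require Import all_classical all_reals all_analysis.
From mathcomp Require Import complex zify ring lra.

(** Let [k] be the number of vertices of [P]. If a graph [T] has a vertex [m] with
    [k] leaves attached to it, then these leaves can be permuted arbitrarily, also
    by quantum permutations: a magic unitary [u] of size [k], extended by the
    identity on the other vertices, commutes with the adjacency matrix of [T],
    because all leaves have the same single neighbour and the rows and columns of
    [u] sum to 1. With [u] the fundamental matrix of Aut+(P), the universal
    property of C(Aut+(T)) then gives a homomorphism from C(Aut+(T)) to C(Aut+(P))
    whose range contains the generators and which respects the comultiplications
    ([qaut_subgroup_of_leaves]). So it is enough that almost all trees have a
    vertex with at least [k] leaves.

    That follows from a switching argument ([card_sparse]). Encode a tree by its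
    parent map towards a fixed root. In a tree on [n] vertices where every vertex
    has less than [k] leaves, choose a vertex [z] and [k] vertices with at most one
    child; about half of the vertices, or more, have this property. Then move the
    chosen vertices one after the other to [z], as leaves, letting the parent of
    a moved vertex adopt its child. There are at least of order [n ^ (k + 1)]
    choices. Undoing a move takes one of [2 n] positions, and in the resulting
    tree only boundedly many leaf stars have size at least [k], all of bounded
    size, so that a given tree arises from [O(n ^ k)] choices. Hence the trees at
    the start form a proportion [O(1 / n)] of all trees.

    Turning a matrix into a quantum subgroup takes three facts about C*-algebras,
    which are proved here from the axioms, without spectral theory.
    - A star homomorphism is bounded ([star_hom_bounded]), since a small hermitian
      element is the real part of a unitary.
    - Its range is closed ([star_hom_closed_range]): a hermitian [a] whose image
      is small can be replaced by [a / (1 + a^2)], the real part of a resolvent,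
      which is bounded and has nearly the same image. So the range is a C*-algebra,
      and the universal property of C(Aut+(P)) shows that a range containing the
      generators is everything ([qaut_surjective]).
    - It induces a homomorphism between minimal tensor products ([tensor_map]),
      since representations of the target pull back to the source. *)

Set Implicit Arguments.
Unset Strict Implicit.
Unset Printing Implicit Defensive.

Import Order.TTheory GRing.Theory Num.Theory.
Import numFieldNormedType.Exports.

(** * Trees as parent maps *)

Section RootedTrees.
Variables (T : finType) (r : T).
Implicit Types (f g : {ffun T -> T}) (x y : T).

(** A tree on [T] is encoded by the map sending each vertex to its parent, the
    root [r] being its own parent: such maps are finite functions, on which the
    surgery and the counting below are one-line operations. *)
Definition rooted f := (f r == r) && [forall x, fconnect f x r].

Definition tree_of f : rel T :=
  fun x y => (x != y) && ((f x == y) || (f y == x)).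

(** Since [f r = r], the root never counts as a leaf. *)
Definition leaf f x := [forall y, f y != x].

Lemma rooted_root f : rooted f -> f r = r.
Proof. by case/andP => /eqP. Qed.

Lemma rooted_ind f (P : T -> Prop) : rooted f ->
  P r -> (forall x, x != r -> P (f x) -> P x) -> forall x, P x.
Proof.
move=> /andP[_ /forallP fr] Pr PS x.
have [m] : exists m, iter m f x = r by exists (findex f x r); rewrite iter_findex.
elim: m x => [x /= -> //|m IH x].
rewrite iterSr => /IH Pfx; have [->//|xr] := eqVneq x r; exact: PS.
Qed.

Lemma rooted_depth f : rooted f ->
  exists d : T -> nat, forall x, x != r -> d (f x) < d x.
Proof.
move=> /andP[_ /forallP fr].
have ex x : exists m, iter m f x == r.
  by exists (findex f x r); rewrite iter_findex.
exists (fun x => ex_minn (ex x)) => x xr.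
case: ex_minnP => m _ min_m; case: ex_minnP => -[/= /eqP xE|k]; first by rewrite xE eqxx in xr.
by rewrite iterSr => /min_m mk _.
Qed.

Lemma rooted_of_depth f (d : T -> nat) : f r = r ->
  (forall x, x != r -> d (f x) < d x) -> rooted f.
Proof.
move=> fr df; rewrite /rooted fr eqxx; apply/forallP => x.
have [n] := ubnP (d x); elim: n x => // n IH x lt.
have [->|xr] := eqVneq x r; first exact: connect0.
apply: connect_trans (fconnect1 f x) (IH _ _).
exact: leq_trans (df _ xr) _.
Qed.

Lemma rooted_neq f x : rooted f -> x != r -> f x != x.
Proof.
move=> /rooted_depth[d hd] /hd; apply: contraTneq => ->.
by rewrite ltnn.
Qed.

Lemma rooted_asym f x : rooted f -> f (f x) = x -> x = r.
Proof.
move=> rf ffx; have [d hd] := rooted_depth rf.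
apply/eqP; apply: contraTT isT => xr.
have [fxr|fxr] := eqVneq (f x) r.
  by move: xr; rewrite -ffx fxr rooted_root ?eqxx.
by have := ltn_trans (hd _ fxr) (hd _ xr); rewrite ffx ltnn.
Qed.

Lemma tree_of_sym f : symmetric (tree_of f).
Proof. by move=> x y; rewrite /tree_of eq_sym orbC. Qed.

Lemma tree_of_connected f : rooted f -> forall x y, connect (tree_of f) x y.
Proof.
move=> rf.
have to_root x : connect (tree_of f) x r.
  move: x; apply: (rooted_ind rf) => [|x xr]; first exact: connect0.
  apply: connect_trans; apply: connect1.
  by rewrite /tree_of eq_sym rooted_neq // eqxx.
move=> x y; apply: connect_trans (to_root x) _.
by rewrite (sym_connect_sym (@tree_of_sym f)).
Qed.

(** On a cycle, a vertex of maximal depth has two distinct neighbours that are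
    not deeper than itself; both would be its parent. *)
Lemma tree_of_is_tree f : rooted f -> is_tree (tree_of f).
Proof.
move=> rf; split.
- by split; [exact: tree_of_sym|move=> x; rewrite /tree_of eqxx].
- by split; [apply/card_gt0P; exists r|exact: tree_of_connected].
move=> c uc; rewrite ltnNge; apply/negP => c3.
have [d hd] := rooted_depth rf.
have [x0 x0c] : exists x0, x0 \in c.
  by case: c c3 {uc} => // x0 c _; exists x0; rewrite mem_head.
case: (@arg_maxnP _ x0 (mem c) d x0c) => x xc max_x.
have [i c' ce] := rot_to xc.
move: uc; rewrite -(rot_ucycle i) ce => uc.
have sz : 2 < size (x :: c') by rewrite -ce size_rot.
have mem_c y : y \in x :: c' -> d y <= d x.
  by rewrite -ce mem_rot => /max_x.
case: c' ce uc sz mem_c => [//|y [//|z c']] _ + _ mem_c.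
have only_parent w : w \in [:: x, y, z & c'] -> tree_of f x w -> f x = w.
  move=> wc /andP[xw] /orP[/eqP//|/eqP fwx].
  have [wr|wr] := eqVneq w r.
    by move: xw; rewrite -fwx wr rooted_root ?eqxx.
  by have := hd _ wr; rewrite fwx ltnNge mem_c.
rewrite /ucycle /= rcons_path => /andP[/and3P[xy yz /andP[_ zx]]].
rewrite tree_of_sym in zx.
have yc : y \in [:: x, y, z & c'] by rewrite !in_cons eqxx orbT.
have zc : last z c' \in [:: x, y, z & c'] by rewrite 2!in_cons mem_last !orbT.
have yz' : y = last z c' by rewrite -(only_parent y yc xy) (only_parent _ zc zx).
by case/and3P => _; rewrite {1}yz' mem_last.
Qed.

(** Climbing down from the root: if the parent of [x] has the same parent under
    [f] and [g], then an edge between [x] and [f x] can only mean [g x = f x]. *)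
Lemma tree_of_inj f g : rooted f -> rooted g -> tree_of f =2 tree_of g -> f = g.
Proof.
move=> rf rg fg; apply/ffunP; apply: (rooted_ind rf).
  by rewrite !rooted_root.
move=> x xr IH.
have := fg x (f x); rewrite /tree_of eqxx eq_sym rooted_neq //= => /esym/orP[/eqP//|].
move=> /eqP gfx; have := rooted_asym rf (x := x); rewrite IH gfx => /(_ erefl) xE.
by rewrite xE eqxx in xr.
Qed.

(** The parent of [x] is a neighbour closer to the root. The tree so obtained
    spans [T], so an edge of [e] outside it would close a cycle. *)
Lemma is_tree_parent (e : rel T) : is_tree e ->
  exists2 f, rooted f & e =2 tree_of f.
Proof.
move=> [[esym eirr] [_ econ] acyc].
pose to_root x k := [exists p : k.-tuple T, path e x p && (last x p == r)].
have ex x : exists k, to_root x k.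
  have /connectP[p ep lp] := econ x r.
  by exists (size p); apply/existsP; exists (in_tuple p); rewrite ep lp eqxx.
pose d x := ex_minn (ex x).
have step x : x != r -> exists2 y, e x y & d y < d x.
  rewrite /d; case: ex_minnP => k /existsP[p /andP[]].
  case: p => -[|y p] //= /eqP kE; first by move=> _ ->.
  move=> /andP[exy ep] lp _ _; exists y => //.
  case: ex_minnP => m _; rewrite -kE ltnS; apply.
  by apply/existsP; exists (in_tuple p); rewrite ep lp.
pose f := [ffun x => odflt x [pick y | e x y && (d y < d x)]].
have fP x : x != r -> e x (f x) && (d (f x) < d x).
  move=> xr; rewrite ffunE; case: pickP => [y //|none].
  by have [y exy lt] := step x xr; move: (none y); rewrite exy lt.
have fr : f r = r.
  rewrite ffunE; case: pickP => // y /andP[_].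
  suff -> : d r = 0 by [].
  rewrite /d; case: ex_minnP => m _ /(_ 0) min0.
  apply/eqP; rewrite -leqn0 min0 //.
  by apply/existsP; exists [tuple]; rewrite /= eqxx.
have rf : rooted f.
  by apply: (@rooted_of_depth _ d) => // x /fP /andP[].
have sub : subrel (tree_of f) e.
  move=> a b /andP[ab /orP[]/eqP E].
    have [ar|/fP] := eqVneq a r; first by rewrite -E ar fr eqxx in ab.
    by rewrite E => /andP[].
  have [br|/fP] := eqVneq b r; first by rewrite -E br fr eqxx in ab.
  by rewrite E esym => /andP[].
exists f => // x y; apply/idP/idP => [exy|]; last exact: sub.
apply: contraT => nxy.
have /connectP[p0 tp yE] := tree_of_connected rf x y.
case/shortenP: tp yE => p tp up _ yE.
have := acyc (x :: p); rewrite /ucycle /= rcons_path (sub_path sub tp) -yE esym exy.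
move: up => /= -> /(_ isT); case: p tp yE => [|z [|z' p]] //=.
  by move=> _ yE; rewrite yE eirr in exy.
by rewrite andbT => + zE; rewrite -zE (negbTE nxy).
Qed.

Lemma leaf_tree_of f x y : leaf f x -> tree_of f x y = (y == f x).
Proof.
move=> /forallP lx; rewrite /tree_of (negbTE (lx y)) orbF [RHS]eq_sym.
have [<-|//] := eqVneq x y; exact/esym/negbTE.
Qed.

End RootedTrees.

(** * Almost all trees have a vertex with many leaves *)

Section Fibres.
Variables (S T : finType) (h : S -> T) (A : {set S}) (B : {set T}) (m : nat).

Lemma card_le_fibres : (forall a, a \in A -> h a \in B) ->
  (forall b, b \in B -> #|[set a in A | h a == b]| <= m) -> #|A| <= m * #|B|.
Proof.
move=> hAB fib; rewrite -sum1_card (partition_big h (mem B)) //= mulnC -sum_nat_const.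
by apply: leq_sum => b /fib; rewrite -sum1dep_card.
Qed.

Lemma card_ge_fibres :
  (forall b, b \in B -> m <= #|[set a in A | h a == b]|) -> m * #|B| <= #|A|.
Proof.
move=> fib; rewrite mulnC -sum_nat_const.
apply: (@leq_trans (\sum_(b in B) \sum_(a in A | h a == b) 1)).
  by apply: leq_sum => b /fib; rewrite -sum1dep_card.
rewrite -[#|A|]sum1_card [leqRHS](bigID (fun a => h a \in B)) /=.
apply: leq_trans (leq_addr _ _).
rewrite [leqRHS](partition_big h (mem B)) /= => [|a /andP[]//].
apply: leq_sum => b bB; rewrite leq_eqVlt; apply/orP; left; apply/eqP.
by apply: eq_bigl => a; case: eqP => [->|_]; rewrite ?bB !(andbT, andbF).
Qed.

End Fibres.

Lemma leq_expn a b e : a <= b -> a ^ e <= b ^ e.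
Proof. by move=> ab; elim: e => // e IH; rewrite !expnS leq_mul. Qed.

Lemma ffact_ge m k : (m - k) ^ k <= m ^_ k.
Proof.
elim: k m => [|k IH] [|m] //; first by rewrite sub0n exp0n.
rewrite subSS ffactSS expnS leq_mul ?IH //; lia.
Qed.

Section Switching.
Variables (T : finType) (r : T) (V : finType).
Implicit Types (f : {ffun T -> T}) (s : {ffun V -> T}) (x y z t : T) (D : {set V}).

Local Notation k := #|V|.
Local Notation state := ({ffun T -> T} * ({ffun V -> T} * T))%type.

Definition children f t := [set y | f y == t].
Definition leaves f t := [set y | leaf f y && (f y == t)].
Definition crowded f := [set t | k <= #|leaves f t|].
Definition sparse f := rooted r f && [forall t, #|leaves f t| < k].

(** The elementary move: [t] becomes a leaf hanging from [z], and its former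
    parent adopts its children. *)
Definition detach f t z : {ffun T -> T} :=
  [ffun y => if y == t then z else if f y == t then f t else f y].

Lemma detach_self f t z : detach f t z t = z.
Proof. by rewrite ffunE eqxx. Qed.

Lemma detach_child f t z y : y != t -> f y = t -> detach f t z y = f t.
Proof. by move=> yt fy; rewrite ffunE (negbTE yt) fy eqxx. Qed.

Lemma detach_other f t z y : y != t -> f y != t -> detach f t z y = f y.
Proof. by move=> yt fy; rewrite ffunE (negbTE yt) (negbTE fy). Qed.

Lemma detach_neq f t z : rooted r f -> t != r -> z != t ->
  forall y, detach f t z y != t.
Proof.
move=> rf tr zt y; have ft := rooted_neq rf tr.
by rewrite ffunE; case: (y == t) => //; case: (f y =P t) => [_|/eqP].
Qed.

Lemma leaf_detach f t z : rooted r f -> t != r -> z != t -> leaf (detach f t z) t.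
Proof. by move=> rf tr zt; apply/forallP; exact: detach_neq. Qed.

(** A depth function for [f] stays one when [t] is given any depth larger than
    that of [z], because [t] has no children left. *)
Lemma rooted_detach f t z : rooted r f -> t != r -> z != t ->
  rooted r (detach f t z).
Proof.
move=> rf tr zt; have [d hd] := rooted_depth rf.
have ft := rooted_neq rf tr.
apply: (@rooted_of_depth _ _ _ (fun y => if y == t then (d z).+1 else d y)).
  by rewrite detach_other ?rooted_root // eq_sym.
move=> y yr; rewrite (negbTE (detach_neq rf tr zt y)).
have [->|yt] := eqVneq y t; first by rewrite detach_self.
have [fy|fy] := eqVneq (f y) t; last by rewrite detach_other ?hd.
rewrite detach_child //; apply: ltn_trans (hd _ tr) _.
by rewrite -fy hd.
Qed.

(** One move creates few leaves: the only candidates are [t] itself, its parent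
    (when it has lost its only child) and its child (when it has changed
    parent). *)
Lemma new_leaves_detach f t z : rooted r f -> t != r -> z != t ->
  #|children f t| <= 1 ->
  #|[set y | leaf (detach f t z) y && ~~ (leaf f y && (f y == detach f t z y))]| <= 3.
Proof.
move=> rf tr zt c1.
apply: (@leq_trans #|[set t; f t] :|: children f t|); last first.
  rewrite (leq_trans (leq_card_setU _ _)) // (@leq_add _ _ 2 1) // cards2.
  by case: (_ != _).
apply: subset_leq_card; apply/fintype.subsetP => y; rewrite !inE => /andP[ly]; apply: contraR.
rewrite !negb_or => /andP[/andP[yt yft] fyt].
rewrite detach_other // eqxx andbT.
apply/forallP => w; apply: contraNneq yft => fwy.
have [wt|wt] := eqVneq w t; first by rewrite -fwy wt.
by move/forallP: ly => /(_ w); rewrite detach_other ?fwy ?eqxx.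
Qed.

(** The state of the switching once the vertices [s v], [v \in D], have been
    moved to [z]. The last two fields bound the number of leaf stars of [f], each
    move adding at most 3 by [new_leaves_detach]; they are what makes the final
    tree remember the moved vertices up to boundedly many choices. *)
Record stage D f s z : Prop := Stage {
  stage_rooted : rooted r f;
  stage_inj : injective s;
  stage_root : forall v, s v != r;
  stage_target : forall v, z != s v;
  stage_done : forall v, v \in D -> leaf f (s v) /\ f (s v) = z;
  stage_todo : forall v, v \notin D -> #|children f (s v)| <= 1;
  stage_leaves : forall t, #|leaves f t| <= k + 3 * #|D|;
  stage_crowded : #|crowded f| <= 3 * #|D|
}.

Lemma stage_detach D f s z v : stage D f s z -> v \notin D ->
  stage (v |: D) (detach f (s v) z) s z.
Proof.
case=> rf sI sr sz done todo few crowd vD.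
have tr := sr v; have zt := sz v; have c1 := todo _ vD.
set t := s v in tr zt c1 *.
have Ex3 := new_leaves_detach rf tr zt c1.
set Ex := [set y | _] in Ex3.
have sub u : leaves (detach f t z) u \subset
    leaves f u :|: [set y in Ex | detach f t z y == u].
  apply/fintype.subsetP => y; rewrite !inE => /andP[ly /eqP fy]; rewrite ly fy eqxx !andbT /=.
  by case: (leaf f y && _).
split=> //.
- exact: rooted_detach.
- move=> w; rewrite in_setU1 => /orP[/eqP ->|wD].
    by split; [exact: leaf_detach|rewrite detach_self].
  have wt : s w != t by apply: contraNneq vD => /sI <-.
  have [lw fw] := done _ wD; split; last by rewrite detach_other // fw.
  apply/forallP => y; move/forallP: lw => lw.
  have [->|yt] := eqVneq y t; first by rewrite detach_self sz.
  have [fy|fy] := eqVneq (f y) t; last by rewrite detach_other.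
  by rewrite detach_child.
- move=> w; rewrite in_setU1 negb_or => /andP[wv wD].
  have wt : s w != t by apply: contraNneq wv => /sI ->.
  have parent y : detach f t z y = s w -> f y = s w \/ f y = t /\ f t = s w.
    have [->|yt] := eqVneq y t; first by rewrite detach_self => zE; have := sz w; rewrite zE eqxx.
    have [fy|fy] := eqVneq (f y) t; last by rewrite detach_other //; left.
    by rewrite detach_child //; right.
  have uniq := card_le1_eqP (todo _ wD).
  have uniq_t := card_le1_eqP c1.
  apply/card_le1_eqP => y y'; rewrite !inE => /eqP ey /eqP ey'.
  have yt : y != t by apply: contraTneq (sz w) => yE; rewrite -ey yE detach_self eqxx.
  have y't : y' != t by apply: contraTneq (sz w) => yE; rewrite -ey' yE detach_self eqxx.
  case: (parent _ ey) (parent _ ey') => [fy|[fy ft]] [fy'|[fy' ft']].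
  + by apply: uniq; rewrite inE ?fy ?fy'.
  + by case/eqP: yt; apply: uniq; rewrite inE ?fy ?ft'.
  + by case/eqP: y't; apply: uniq; rewrite inE ?fy' ?ft.
  + by apply: uniq_t; rewrite inE ?fy ?fy'.
- move=> u; rewrite cardsU1 vD mulnDr addnCA addnC.
  apply: leq_trans (subset_leq_card (sub u)) _.
  apply: leq_trans (leq_card_setU _ _) _; apply: leq_add => //.
  apply: leq_trans Ex3; apply: subset_leq_card; apply/fintype.subsetP => y.
  by rewrite inE => /andP[].
- rewrite cardsU1 vD mulnDr addnC.
  apply: (@leq_trans #|crowded f :|: [set detach f t z y | y in Ex]|).
    apply: subset_leq_card; apply/fintype.subsetP => u; rewrite !inE => ku.
    case: leqP => //= uk; apply: contraLR uk => nex; rewrite -leqNgt.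
    apply: leq_trans ku _; apply: leq_trans (subset_leq_card (sub u)) _.
    apply: subset_leq_card; rewrite finset.subUset subxx; apply/fintype.subsetP => y.
    by rewrite inE => /andP[yEx /eqP yu]; case/negP: nex; rewrite -yu imset_f.
  apply: leq_trans (leq_card_setU _ _) _; apply: leq_add => //.
  exact: leq_trans (leq_imset_card _ _) Ex3.
Qed.

(** What has to be remembered of [f] to undo the detachment of a vertex [t] with
    at most one child. If [t] had a child, that child alone tells where [t] goes
    back: between it and the vertex that adopted it. *)
Definition position f t : T + T :=
  if [pick y | f y == t] is Some y then inl y else inr (f t).

(** A move is undone from one of [2 * #|T|] positions. This is why only vertices
    with at most one child are moved: a set of adopted children could not be
    recovered cheaply. *)
Lemma detach_position_inj f g t z : rooted r f -> rooted r g -> t != r ->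
  #|children f t| <= 1 -> #|children g t| <= 1 ->
  detach f t z = detach g t z -> position f t = position g t -> f = g.
Proof.
move=> rf rg tr f1 g1 fg; rewrite /position.
have ft := rooted_neq rf tr; have gt := rooted_neq rg tr.
have uf := card_le1_eqP f1; have ug := card_le1_eqP g1.
case: pickP => [b /eqP fb|nof]; case: pickP => [b' /eqP gb|nog] //.
- move=> [bE]; subst b'.
  have bt : b != t by apply: contraNneq ft => bE; rewrite -{1}bE fb.
  have ftg : f t = g t.
    by move/ffunP: fg => /(_ b); rewrite !detach_child.
  apply/ffunP => y; have [->//|yt] := eqVneq y t.
  have [->|yb] := eqVneq y b; first by rewrite fb gb.
  have nf : f y != t by apply: contraNneq yb => fy; apply/eqP/uf; rewrite inE ?fy ?fb.
  have ng : g y != t by apply: contraNneq yb => gy; apply/eqP/ug; rewrite inE ?gy ?gb.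
  by move/ffunP: fg => /(_ y); rewrite !detach_other.
- move=> [ftg]; apply/ffunP => y; have [->//|yt] := eqVneq y t.
  by move/ffunP: fg => /(_ y); rewrite !detach_other ?nof ?nog.
Qed.

Definition stage_set D : {set state} :=
  [set q | `[< stage D q.1 q.2.1 q.2.2 >]].

Lemma stage_setP D q : reflect (stage D q.1 q.2.1 q.2.2) (q \in stage_set D).
Proof. by rewrite inE; exact: asboolP. Qed.

Lemma card_stage_set_step D v : v \notin D ->
  #|stage_set D| <= 2 * #|T| * #|stage_set (v |: D)|.
Proof.
move=> vD; pose h (q : state) := (detach q.1 (q.2.1 v) q.2.2, q.2).
apply: (card_le_fibres (h := h)) => [[f [s z]] /stage_setP st|[g sz] _].
  by apply/stage_setP; exact: stage_detach.
have -> : 2 * #|T| = #|{: T + T}| by rewrite card_sum mul2n addnn.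
rewrite -(card_in_imset (f := fun q : state => position q.1 (q.2.1 v))); first exact: max_card.
move=> [f [s z]] [f' [s' z']]; rewrite !inE /=.
move=> /andP[/asboolP st /eqP[fg sE]] /andP[/asboolP st' /eqP[fg' sE']] pos.
move: sE sE' => <- [sE zE]; subst s' z'.
suff -> : f = f' by [].
apply: (detach_position_inj (z := z)) pos; rewrite ?(stage_rooted st) ?(stage_rooted st') //.
- exact: (stage_root st).
- exact: (stage_todo st).
- exact: (stage_todo st').
- by rewrite fg fg'.
Qed.

Lemma card_stage_set D :
  #|stage_set D| <= (2 * #|T|) ^ #|~: D| * #|stage_set [set: V]|.
Proof.
have [n] := ubnP #|~: D|; elim: n D => // n IH D lt.
have [D0|[v]] := set_0Vmem (~: D).
  by rewrite D0 cards0 mul1n -[D]finset.setCK D0 finset.setC0.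
move=> vD; have cE : #|~: D| = #|~: (v |: D)|.+1.
  by rewrite (cardsD1 v) vD finset.setDE finset.setCU finset.setIC add1n.
rewrite inE in vD.
apply: leq_trans (card_stage_set_step vD) _.
by rewrite cE expnS -[leqRHS]mulnA leq_mul2l IH ?orbT //; rewrite cE in lt.
Qed.

(** In a final state, [z] is one of the few crowded vertices, and the [s v] are
    among its boundedly many leaves: the number of final states exceeds the
    number of trees by a constant factor only. *)
Lemma card_stage_setT :
  #|stage_set [set: V]| <= (4 * k) ^ k * (3 * k) * #|[set f | rooted r f]|.
Proof.
apply: (card_le_fibres (h := fst)) => [q /stage_setP st|f _].
  by rewrite inE (stage_rooted st).
have [->|[q0]] := set_0Vmem [set a in stage_set [set: V] | a.1 == f]; first by rewrite cards0.
rewrite inE => /andP[/stage_setP st0 /eqP fE]; rewrite fE in st0.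
apply: leq_trans (_ : (4 * k) ^ k * #|crowded f| <= _); last first.
  by rewrite leq_mul2l; have := stage_crowded st0; rewrite cardsT => ->; rewrite orbT.
apply: (card_le_fibres (h := fun q : state => q.2.2)) => [q|z _].
  rewrite inE => /andP[/stage_setP st /eqP qf]; rewrite inE -qf.
  rewrite -cardsT -(card_imset _ (stage_inj st)).
  apply: subset_leq_card; apply/fintype.subsetP => _ /imsetP[v _ ->].
  by have [l e] := stage_done st (finset.in_setT v); rewrite inE l e eqxx.
apply: (@leq_trans #|[set s in ffun_on (mem (leaves f z)) | true : bool] : {set {ffun V -> T}}|).
  rewrite -(card_in_imset (f := fun q : state => q.2.1)).
    apply: subset_leq_card; apply/fintype.subsetP => _ /imsetP[q + ->].
    rewrite !inE => /andP[/andP[/asboolP st /eqP qf] /eqP qz].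
    rewrite andbT; apply/ffun_onP => v.
    by have [l e] := stage_done st (finset.in_setT v); rewrite inE -qf l e qz eqxx.
  move=> [g [s y]] [g' [s' y']]; rewrite !inE /=.
  by move=> /andP[/andP[_ /eqP ->] /eqP ->] /andP[/andP[_ /eqP ->] /eqP ->] ->.
have -> : #|[set s in ffun_on (mem (leaves f z)) | true : bool] : {set {ffun V -> T}}| = #|leaves f z| ^ k.
  by rewrite -card_ffun_on; apply: eq_card => s; rewrite inE andbT.
have leK : #|leaves f z| <= 4 * k.
  by have := stage_leaves st0 z; rewrite cardsT; lia.
exact: leq_expn.
Qed.

Definition movable f := [set t | (t != r) && (#|children f t| <= 1)].

(** At most half of the vertices have two children or more, as the numbers of
    children add up to [#|T|]. *)
Lemma card_movable f : #|T| <= 2 * #|movable f| + 2.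
Proof.
pose H := [set t | 2 <= #|children f t|].
have H2 : 2 * #|H| <= #|T|.
  rewrite -[#|T|]cardsT; apply: (card_ge_fibres (h := f)) => t.
  by rewrite inE => /leq_trans; apply; apply: subset_leq_card; apply/fintype.subsetP => y; rewrite !inE.
have : #|[set: T]| <= #|movable f| + #|H| + #|[set r]|.
  apply: leq_trans (leq_trans (leq_card_setU (movable f :|: H) [set r]) _); last first.
    by rewrite leq_add2r leq_card_setU.
  apply: subset_leq_card; apply/fintype.subsetP => t _; rewrite !inE.
  by case: (t == r); rewrite ?orbT //= orbF; case: leqP.
by rewrite cardsT cards1; lia.
Qed.

(** From a sparse tree the switching may start in about [#|T| ^ (k + 1)] ways: an
    injective choice of [k] movable vertices, and the choice of [z]. *)
Lemma card_stage_set0 : 4 * k + 8 <= #|T| ->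
  #|T| ^ k * #|T| * #|[set f | sparse f]| <= 2 * 4 ^ k * #|stage_set finset.set0|.
Proof.
move=> kT.
pose N := ((#|T| - 2)./2 - k) ^ k * (#|T| - k).
have NE : #|T| ^ k * #|T| <= 2 * 4 ^ k * N.
  have h1 : #|T| ^ k <= 4 ^ k * ((#|T| - 2)./2 - k) ^ k.
    by rewrite -expnMn; apply: leq_expn; lia.
  have h2 : #|T| <= 2 * (#|T| - k) by lia.
  by have := leq_mul h1 h2; rewrite /N; lia.
apply: leq_trans (leq_mul NE (leqnn _)) _; rewrite -mulnA leq_mul2l.
apply/orP; right; apply: (card_ge_fibres (h := fst)) => f.
rewrite inE => /andP[rf /forallP sf].
have crowd0 : crowded f = finset.set0.
  by apply/finset.setP => t; rewrite !inE leqNgt sf.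
rewrite /N.
pose I := [set s : {ffun V -> T} in ffun_on (mem (movable f)) | injectiveb s].
have cI : ((#|T| - 2)./2 - k) ^ k <= #|I|.
  rewrite card_inj_ffuns_on; apply: leq_trans (ffact_ge _ _).
  have M : (#|T| - 2)./2 <= #|movable f| by have := card_movable f; lia.
  by apply/leq_expn/leq_sub2r.
rewrite mulnC; apply: leq_trans (leq_mul (leqnn _) cI) _.
apply: (card_ge_fibres (h := fun q : state => q.2.1)) => s.
rewrite inE => /andP[/ffun_onP mov /injectiveP sI].
rewrite leq_subLR -(card_imset predT sI) -cardsT.
rewrite -(cardsID [set s v | v in V]) leq_add //.
  by apply: subset_leq_card; apply/fintype.subsetP => t; rewrite inE => /andP[].
rewrite -(card_in_imset (f := fun z => (f, (s, z)) : state)); last by move=> z z' _ _ [].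
apply: subset_leq_card; apply/fintype.subsetP => _ /imsetP[z + ->].
rewrite !inE andbT => zs; rewrite !eqxx !andbT; apply/asboolP; split=> //=.
- by move=> v; have := mov v; rewrite inE => /andP[].
- by move=> v; apply: contraNneq zs => ->; rewrite imset_f.
- by move=> v; rewrite inE.
- by move=> v _; have := mov v; rewrite inE => /andP[].
- by move=> t; rewrite cards0 addn0 ltnW.
- by rewrite crowd0 cards0.
Qed.

(** The [k] moves lose a factor [(2 * #|T|) ^ k] only, so one factor [#|T|], the
    free choice of [z], is gained. *)
Lemma card_sparse : 4 * k + 8 <= #|T| ->
  #|T| * #|[set f | sparse f]| <=
  (6 * k * 8 ^ k * (4 * k) ^ k) * #|[set f | rooted r f]|.
Proof.
move=> kT; have T0 : 0 < #|T| ^ k by rewrite expn_gt0; apply/orP; left; lia.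
rewrite -(leq_pmul2l T0) mulnA; apply: leq_trans (card_stage_set0 kT) _.
have h := leq_trans (card_stage_set finset.set0) (leq_mul (leqnn _) card_stage_setT).
rewrite finset.setC0 cardsT expnMn in h.
apply: leq_trans (leq_mul (leqnn _) h) _.
have -> : 8 ^ k = 2 ^ k * 4 ^ k by rewrite -expnMn.
by rewrite leq_eqVlt; apply/orP; left; apply/eqP; nia.
Qed.

End Switching.

(** * Norms, resolvents and boundedness in C*-algebras *)

Local Open Scope ring_scope.

Section Norm.
Variables (R : realType) (A : cstarType R).
Implicit Types (a b x y : A) (q C : R).

Lemma cnormZr (c : R) a : cnorm (c%:C%C *: a) = `|c| * cnorm a.
Proof.
have := congr1 (@complex.Re R) (cnormZ c%:C%C a).
by rewrite normc_def /= expr0n /= addr0 sqrtr_sqr !mul0r subr0.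
Qed.

Lemma cnormZ1 (z : R[i]) a : `|z| = 1 -> cnorm (z *: a) = cnorm a.
Proof.
by move=> z1; have := congr1 (@complex.Re R) (cnormZ z a); rewrite z1 mul1r.
Qed.

Lemma cnorm0 : cnorm (0 : A) = 0.
Proof. by have := cnormZr 0 0; rewrite scaler0 normr0 mul0r. Qed.

Lemma cnormN a : cnorm (- a) = cnorm a.
Proof. by rewrite -scaleN1r cnormZ1 // normrN1. Qed.

Lemma cnorm_ge0 a : 0 <= cnorm a.
Proof. by have := cnormD a (- a); rewrite subrr cnorm0 cnormN; lra. Qed.

Lemma cnormB a b : cnorm (a - b) <= cnorm a + cnorm b.
Proof. by rewrite -(cnormN b) cnormD. Qed.

Lemma cnorm_distC a b : cnorm (a - b) = cnorm (b - a).
Proof. by rewrite -cnormN opprB. Qed.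

Lemma cnorm_dist_trans b a c :
  cnorm (a - c) <= cnorm (a - b) + cnorm (b - c).
Proof.
have -> : a - c = (a - b) + (b - c) by rewrite addrA subrK.
exact: cnormD.
Qed.

Lemma cnormZ_half a : cnorm (2^-1 *: a) = 2^-1 * cnorm a.
Proof.
have <- : (2^-1 : R)%:C%C = 2^-1 by rewrite fmorphV rmorph_nat.
by rewrite cnormZr ger0_norm // invr_ge0.
Qed.

Lemma star0 : star (0 : A) = 0.
Proof. by have := starZ 0 (0 : A); rewrite scaler0 conjC0 scale0r. Qed.

Lemma starN a : star (- a) = - star a.
Proof. by rewrite -scaleN1r starZ conjCN1 scaleN1r. Qed.

Lemma starB a b : star (a - b) = star a - star b.
Proof. by rewrite starD starN. Qed.

Lemma star1 : star (1 : A) = 1.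
Proof. by rewrite -[LHS]mulr1 -{2}(starK 1) -starM mulr1 starK. Qed.

Lemma star_sum (I : Type) (r : seq I) (F : I -> A) :
  star (\sum_(i <- r) F i) = \sum_(i <- r) star (F i).
Proof.
by elim/big_rec2: _ => [|i y1 y2 _ <-]; rewrite ?star0 ?starD.
Qed.

Lemma cnorm_star a : cnorm (star a) = cnorm a.
Proof.
suff le b : cnorm b <= cnorm (star b).
  by apply/eqP; rewrite eq_le le -{2}(starK a) le.
have [->|b0] := eqVneq (cnorm b) 0; first exact: cnorm_ge0.
have bp : 0 < cnorm b by rewrite lt_def b0 cnorm_ge0.
rewrite -(ler_pM2r bp) -expr2 -cstar_identity.
exact: cnormM.
Qed.

Lemma cnorm_hermitian_sqr a : star a = a -> cnorm (a * a) = cnorm a ^+ 2.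
Proof. by move=> sa; rewrite -cstar_identity sa. Qed.

Lemma cnorm1_le : cnorm (1 : A) <= 1.
Proof.
have := cnorm_hermitian_sqr star1; rewrite mulr1; have := cnorm_ge0 1.
set c := cnorm _ => c0 cc; rewrite leNgt; apply/negP => c1.
by move: cc c1; nra.
Qed.

Lemma cnormX a n : cnorm (a ^+ n) <= cnorm a ^+ n.
Proof.
elim: n => [|n IH]; first by rewrite !expr0 cnorm1_le.
rewrite !exprS (le_trans (cnormM _ _)) // ler_wpM2l //; exact: cnorm_ge0.
Qed.

Lemma geometric_small q C (eps : R) : 0 <= q < 1 -> 0 < eps ->
  exists N, forall n, (N <= n)%N -> C * q ^+ n < eps.
Proof.
move=> /andP[q0 q1] e0.
have : ((geometric C q : nat -> R) n @[n --> \oo] --> (0 : R))%classic.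
  by apply: cvg_geometric; rewrite ger0_norm.
move/cvgrPdist_lt => /(_ _ e0) [N _ HN]; exists N => n /HN /=.
by rewrite sub0r normrN; apply: le_lt_trans; rewrite ler_norm.
Qed.

Lemma cnorm_geometric_eq0 q C a : 0 <= q < 1 ->
  (forall n, cnorm a <= C * q ^+ n) -> a = 0.
Proof.
move=> hq le; apply: cnorm_eq0; apply/eqP.
rewrite eq_le cnorm_ge0 andbT leNgt; apply/negP => a0.
have [N /(_ N (leqnn N))] := geometric_small C hq a0.
by rewrite ltNge le.
Qed.

(** All limits below are limits of sequences with geometric steps. The explicit
    rate lets [cnorm_geometric_eq0] prove equations satisfied by the limit. *)
Lemma geometric_limit q C (x : nat -> A) : 0 <= q < 1 -> 0 <= C ->
  (forall n, cnorm (x n.+1 - x n) <= C * q ^+ n) ->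
  exists l, forall n, cnorm (l - x n) <= C / (1 - q) * q ^+ n.
Proof.
move=> hq C0 step; have /andP[q0 q1] := hq.
have q1' : 0 < 1 - q by rewrite subr_gt0.
set K := C / (1 - q).
have K0 : 0 <= K by rewrite divr_ge0 // ltW.
have KE : C = K * (1 - q) by rewrite /K divfK ?gt_eqF.
have dist n m : cnorm (x (n + m)%N - x n) <= K * q ^+ n.
  suff: cnorm (x (n + m)%N - x n) <= K * q ^+ n * (1 - q ^+ m).
    move=> h; apply: le_trans h _.
    apply: ler_piMr; first by rewrite mulr_ge0 ?exprn_ge0.
    by rewrite lerBlDr lerDl exprn_ge0.
  elim: m => [|m IH]; first by rewrite addn0 subrr cnorm0 expr0 subrr mulr0.
  rewrite addnS; apply: le_trans (cnorm_dist_trans (x (n + m)%N) _ _) _.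
  apply: le_trans (lerD (step _) IH) _.
  by rewrite KE exprD exprS le_eqVlt; apply/orP; left; apply/eqP; ring.
have dist2 n m : (n <= m)%N -> cnorm (x m - x n) <= K * q ^+ n.
  by move=> nm; rewrite -(subnKC nm).
have [eps e0|l hl] := @cnorm_complete R A x.
  have e2 : 0 < eps / 2 by rewrite divr_gt0.
  have [N HN] := geometric_small K hq e2.
  exists N => m n Nm Nn.
  apply: le_lt_trans (cnorm_dist_trans (x N) _ _) _.
  rewrite (cnorm_distC (x N)); have := HN _ (leqnn N).
  by have := dist2 _ _ Nm; have := dist2 _ _ Nn; lra.
exists l => n; apply/ler_addgt0Pr => eps e0.
have [N HN] := hl _ e0.
apply: le_trans (cnorm_dist_trans (x (maxn N n)) _ _) _.
rewrite addrC lerD ?dist2 ?leq_maxr //.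
by rewrite cnorm_distC ltW // HN // leq_maxl.
Qed.

End Norm.

Section Resolvent.
Variables (R : realType) (A : cstarType R).
Implicit Types (a b x y r : A).

Lemma neumann_inverse y : cnorm y < 1 ->
  exists w, (1 - y) * w = 1 /\ w * (1 - y) = 1.
Proof.
move=> y1; have hq : 0 <= cnorm y < 1 by rewrite cnorm_ge0.
pose x n := \sum_(i < n) y ^+ i.
have xS n : x n.+1 - x n = y ^+ n by rewrite /x big_ord_recr /= addrAC subrr add0r.
have xM n : (1 - y) * x n = 1 - y ^+ n.
  by rewrite -[LHS]opprK -mulNr opprB -subrX1 opprB.
have comm n : x n * (1 - y) = (1 - y) * x n.
  apply: commr_sym; apply: commr_sum => i _; apply: commrX.
  by apply: commr_sym; apply: commrB => //; apply: commr1.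
have [||l hl] := @geometric_limit R A (cnorm y) 1 x hq.
- by [].
- by move=> n; rewrite xS mul1r cnormX.
move: (1 / _) hl => K hl.
exists l; split; apply/eqP; rewrite -subr_eq0; apply/eqP;
  apply: (@cnorm_geometric_eq0 R A (cnorm y)
    (cnorm (1 - y) * K + 1) _ hq) => n.
- have -> : (1 - y) * l - 1 = (1 - y) * (l - x n) - y ^+ n.
    by rewrite mulrBr xM opprB addrA addrAC addrK addrC.
  apply: le_trans (cnormB _ _) _.
  apply: le_trans (lerD (cnormM _ _) (cnormX _ _)) _.
  by rewrite [leRHS]mulrDl -mulrA mul1r lerD2r ler_wpM2l ?cnorm_ge0.
- have -> : l * (1 - y) - 1 = (l - x n) * (1 - y) - y ^+ n.
    by rewrite mulrBl comm xM opprB addrA addrAC addrK addrC.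
  apply: le_trans (cnormB _ _) _.
  apply: le_trans (lerD (cnormM _ _) (cnormX _ _)) _.
  rewrite [leRHS]mulrDl -mulrA mul1r lerD2r mulrC.
  by rewrite ler_wpM2l ?cnorm_ge0.
Qed.

(** Two equations rather than an inverse operation, so that star homomorphisms
    visibly carry resolvents to resolvents. *)
Definition is_resolvent a r := r * (a + 'i%:A) = 1 /\ (a + 'i%:A) * r = 1.

Lemma star_i : star ('i%:A : A) = - 'i%:A.
Proof. by rewrite starZ star1 conjCi scaleNr. Qed.

(** For a real [N > 0], the element [1 + ('i / N) (a + 'i)] is
    [(1 - 1 / N) + ('i / N) a], whose squared norm is at most
    [(1 - 1 / N)^2 + (|a| / N)^2] because [a] is hermitian. This is less than 1 for
    [N = |a|^2 + 1], so the multiple [- ('i / N) (a + 'i)] of [a + 'i] is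
    invertible by the Neumann series. *)
Lemma hermitian_resolvent a : star a = a -> exists r, is_resolvent a r.
Proof.
move=> sa; set N := cnorm a ^+ 2 + 1.
have N1 : 1 <= N by rewrite lerDr sqr_ge0.
have N0 : 0 < N by lra.
pose c : R[i] := (N^-1)%:C%C.
have c0 : c != 0 by rewrite /c fmorph_eq0 invr_eq0 gt_eqF.
have cc : Num.conj c = c by rewrite conj_Creal // complex_real.
pose u : A := (1 - c)%:A; pose v : A := ('i * c) *: a.
have comm : u * v = v * u by rewrite /u /v -!scalerAl -!scalerAr mul1r mulr1 scalerA mulrC -scalerA.
have su : star u = u.
  rewrite /u starZ star1; congr (_ *: _).
  by rewrite conj_Creal // rpredB ?rpred1 // complex_real.
have sv : star v = - v by rewrite /v starZ sa rmorphM /= conjCi cc mulNr scaleNr.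
have yy : star (u + v) * (u + v) = ((1 - N^-1) ^+ 2)%:C%C *: 1 + ((N^-1) ^+ 2)%:C%C *: (a * a).
  rewrite starD su sv mulrDr !mulrBl comm addrA subrK.
  rewrite /u /v -!scalerAl -!scalerAr mul1r !scalerA.
  rewrite -scaleNr; congr (_ *: _ + _ *: _).
    by rewrite rmorphXn rmorphB rmorph1 expr2.
  by rewrite mulrACA -expr2 sqrCi mulN1r opprK rmorphXn expr2.
have y1 : cnorm (u + v) < 1.
  have Nle : cnorm (star (u + v) * (u + v)) <= (1 - N^-1) ^+ 2 + N^-1 ^+ 2 * cnorm a ^+ 2.
    rewrite yy; apply: le_trans (cnormD _ _) _; rewrite !cnormZr !ger0_norm ?sqr_ge0 //.
    rewrite lerD //; first by rewrite ler_piMr ?sqr_ge0 // cnorm1_le.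
    by rewrite cnorm_hermitian_sqr.
  rewrite -(@ltr_pXn2r _ 2) ?nnegrE ?cnorm_ge0 ?ler01 // expr1n -cstar_identity.
  apply: le_lt_trans Nle _.
  have -> : cnorm a ^+ 2 = N - 1 by rewrite /N addrK.
  have -> : (1 - N^-1) ^+ 2 + N^-1 ^+ 2 * (N - 1) = 1 - N^-1.
    by field; rewrite gt_eqF.
  by rewrite ltrBlDr ltrDl invr_gt0.
have [w [w1 w2]] := neumann_inverse y1.
have E : 1 - (u + v) = (- ('i * c)) *: (a + 'i%:A).
  rewrite /u /v scalerBl scale1r opprD addrA subKr scalerDr scalerA addrC.
  by rewrite mulNr mulrAC -expr2 sqrCi mulN1r opprK scaleNr.
exists ((- ('i * c)) *: w); split.
- by rewrite -scalerAl scalerAr -E.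
- by rewrite -scalerAr scalerAl -E.
Qed.

Lemma resolvent_star a r : star a = a -> is_resolvent a r ->
  star r * (a - 'i%:A) = 1 /\ (a - 'i%:A) * star r = 1.
Proof.
move=> sa [r1 r2]; have sai : star (a + 'i%:A) = a - 'i%:A.
  by rewrite starD sa star_i.
by split; rewrite -sai -starM ?r1 ?r2 star1.
Qed.

(** [r - star r = - 2 'i (r * star r)], and the right-hand side has norm
    [2 |r|^2] while the left-hand side has norm at most [2 |r|]. *)
Lemma resolvent_norm a r : star a = a -> is_resolvent a r -> cnorm r <= 1.
Proof.
move=> sa rr; have [s1 s2] := resolvent_star sa rr; have [r1 r2] := rr.
have E : r - star r = - (2 * 'i) *: (r * star r).
  have -> : r - star r = r * ((a - 'i%:A) - (a + 'i%:A)) * star r.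
    by rewrite mulrBr mulrBl -mulrA s2 mulr1 r1 mul1r.
  have -> : (a - 'i%:A) - (a + 'i%:A) = (- (2 * 'i))%:A.
    rewrite opprD addrACA subrr add0r -opprD -scalerDl -scaleNr.
    by rewrite mulr_natl mulr2n.
  by rewrite -scalerAr -scalerAl mulr1.
have : cnorm (r - star r) = 2 * cnorm r ^+ 2.
  rewrite E scaleNr cnormN.
  have -> : ((2 : R[i]) = (2 : R)%:C%C) by rewrite rmorph_nat.
  rewrite -scalerA cnormZr ger0_norm ?ler0n // cnormZ1 ?normCi //.
  by rewrite -{1}(starK r) cstar_identity cnorm_star.
have := cnormB r (star r); rewrite cnorm_star.
move: (cnorm (r - star r)) (cnorm_ge0 r) => z; nra.
Qed.

(** The real part of [(a + 'i)^-1] is [r * a * star r = a / (1 + a^2)]: a function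
    of [a] bounded by 1 however large [a] is, which agrees with [a] near 0 up to
    third order. *)
Lemma resolvent_real_part a r : star a = a -> is_resolvent a r ->
  cnorm (2^-1 *: (r + star r) - a) <= cnorm a ^+ 3.
Proof.
move=> sa rr; have [s1 s2] := resolvent_star sa rr; have [r1 r2] := rr.
have rn := resolvent_norm sa rr.
have E1 : 2^-1 *: (r + star r) = r * a * star r.
  have -> : r + star r = r * ((a - 'i%:A) + (a + 'i%:A)) * star r.
    by rewrite mulrDr mulrDl -mulrA s2 mulr1 r1 mul1r.
  rewrite addrACA addNr addr0 -mulr2n mulrnAr mulrnAl -[(_ * _) *+ 2]scaler_nat scalerA.
  by rewrite mulVf ?scale1r // pnatr_eq0.
have E2 : a = r * (a ^+ 3 + a) * star r.
  have -> : a ^+ 3 + a = (a + 'i%:A) * a * (a - 'i%:A).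
    have aI : a * 'i%:A = 'i%:A * a by rewrite -scalerAr -scalerAl mulr1 mul1r.
    have II : 'i%:A * 'i%:A = -1 :> A.
      by rewrite -scalerAl mul1r scalerA -expr2 sqrCi scaleN1r.
    rewrite mulrDl mulrBr !mulrDl.
    have -> : a * a * 'i%:A = 'i%:A * a * a by rewrite -mulrA aI mulrA aI.
    have -> : 'i%:A * a * 'i%:A = - a by rewrite -mulrA aI mulrA II mulN1r.
    by rewrite opprD opprK -addrA addNKr -[a ^+ 3]/(a * (a * a)) mulrA.
  by rewrite !mulrA r1 mul1r -mulrA s2 mulr1.
rewrite E1 {2}E2 -mulrBl -mulrBr opprD addrCA subrr addr0.
apply: le_trans (cnormM _ _) _; rewrite cnorm_star.
apply: le_trans (ler_piMr (cnorm_ge0 _) rn) _.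
apply: le_trans (cnormM _ _) _; rewrite cnormN.
by apply: le_trans (ler_piMl (cnorm_ge0 _) rn) _; exact: cnormX.
Qed.

End Resolvent.

Section Bounded.
Variables (R : realType) (A B : cstarType R) (p : star_hom A B).

Lemma star_hom_resolvent a r : is_resolvent a r -> is_resolvent (p a) (p r).
Proof.
have pi : p 'i%:A = 'i%:A by rewrite linearZ rmorph1.
by case=> r1 r2; split; rewrite -pi -rmorphD -rmorphM ?r1 ?r2 rmorph1.
Qed.

Lemma star_hom_unitary w : star w * w = 1 -> cnorm (p w) <= 1.
Proof.
move=> ww; rewrite -(@ler_pXn2r _ 2) ?nnegrE ?cnorm_ge0 ?ler01 // expr1n.
by rewrite -cstar_identity -star_hom_star -rmorphM ww rmorph1 cnorm1_le.
Qed.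

(** [1 - x] is a square root of [1 - h^2]. The equation says that [x] is a fixed
    point of [x |-> (h^2 + x^2) / 2], a contraction of the ball of radius [1 / 4];
    the iterates from 0 are hermitian and commute with [h]. *)
Lemma sqrt_one_minus_sqr (h : A) : star h = h -> cnorm h <= 2^-1 ->
  exists x, [/\ star x = x, h * x = x * h & x + x = h * h + x * x].
Proof.
move=> sh h2.
pose F x := 2^-1 *: (h * h + x * x).
pose x := fix x n := if n is n'.+1 then F (x n') else 0.
have sF y : star y = y -> star (F y) = F y.
  by move=> sy; rewrite /F starZ starD !starM sh sy fmorphV rmorph_nat.
have cF y : h * y = y * h -> h * F y = F y * h.
  move=> hy; rewrite /F -scalerAr -scalerAl mulrDr mulrDl; congr (_ *: (_ + _)).
    by rewrite mulrA.
  by rewrite mulrA hy -mulrA hy mulrA.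
have dF y z : cnorm (F y - F z) <= 2^-1 * (cnorm y + cnorm z) * cnorm (y - z).
  rewrite /F -scalerBr cnormZ_half -mulrA ler_pM2l ?invr_gt0 ?ltr0n //.
  have -> : h * h + y * y - (h * h + z * z) = y * (y - z) + (y - z) * z.
    rewrite opprD addrACA subrr add0r mulrBr mulrBl addrA subrK //.
  apply: le_trans (cnormD _ _) _; rewrite [leRHS]mulrDl lerD // ?[cnorm z * _]mulrC; exact: cnormM.
have bx n : cnorm (x n) <= 4^-1.
  elim: n => [|n IH] /=; first by rewrite cnorm0 invr_ge0 ler0n.
  rewrite /F cnormZ_half; have := cnormD (h * h) (x n * x n).
  have := cnormM h h; have := cnormM (x n) (x n).
  have := cnorm_ge0 h; have := cnorm_ge0 (x n); nra.
have [|//||l hl] := @geometric_limit R A 4^-1 1 x.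
- by apply/andP; split; lra.
- elim=> [|n IH].
    rewrite expr0 /= subr0 mulr1; have := bx 1%N => /=; lra.
  rewrite exprS; apply: le_trans (dF _ _) _.
  move: IH; rewrite !mul1r; have := bx n; have := bx n.+1.
  have := cnorm_ge0 (x n.+1 - x n); have := cnorm_ge0 (x n).
  have := cnorm_ge0 (x n.+1); nra.
have hq : 0 <= (4^-1 : R) < 1 by apply/andP; split; lra.
move: (1 / _) hl => K hl.
have sx n : star (x n) = x n by elim: n => [|n IH]; [exact: star0|exact: sF].
have cx n : h * x n = x n * h.
  by elim: n => [|n IH]; [rewrite mulr0 mul0r|exact: cF].
have lsa : star l = l.
  apply/eqP; rewrite -subr_eq0; apply/eqP.
  apply: (@cnorm_geometric_eq0 R A 4^-1 (K + K) _ hq) => n.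
  have -> : star l - l = star (l - x n) - (l - x n).
    by rewrite starB sx opprB addrA subrK.
  by apply: le_trans (cnormB _ _) _; rewrite cnorm_star mulrDl lerD.
exists l; split=> //.
- apply/eqP; rewrite -subr_eq0; apply/eqP.
  apply: (@cnorm_geometric_eq0 R A 4^-1 (cnorm h * (K + K)) _ hq) => n.
  have -> : h * l - l * h = h * (l - x n) - (l - x n) * h.
    by rewrite mulrBr mulrBl cx opprB addrA subrK.
  apply: le_trans (cnormB _ _) _.
  have -> : cnorm h * (K + K) * 4^-1 ^+ n =
      cnorm h * (K * 4^-1 ^+ n) + (K * 4^-1 ^+ n) * cnorm h by ring.
  apply: lerD; apply: le_trans (cnormM _ _) _.
  - by rewrite ler_wpM2l ?cnorm_ge0.
  - by rewrite ler_wpM2r ?cnorm_ge0.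
- suff Fl : F l = l.
    rewrite -[in LHS]Fl /F -scalerDl.
    have -> : (2^-1 + 2^-1 : R[i]) = 1 by field.
    by rewrite scale1r.
  apply/eqP; rewrite -subr_eq0; apply/eqP.
  apply: (@cnorm_geometric_eq0 R A 4^-1 (2^-1 * (cnorm l + 1) * K + K) _ hq) => n.
  apply: le_trans (cnorm_dist_trans (x n.+1) _ _) _; rewrite mulrDl lerD //.
    apply: le_trans (dF _ _) _; rewrite -[leRHS]mulrA.
    apply: ler_pM; rewrite ?cnorm_ge0 ?hl // ?mulr_ge0 ?addr_ge0 ?cnorm_ge0 ?invr_ge0 ?ler0n //.
    rewrite ler_pM2l ?invr_gt0 ?ltr0n // lerD2l.
    by have := bx n; lra.
  rewrite cnorm_distC; apply: le_trans (hl n.+1) _.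
  have := le_trans (cnorm_ge0 _) (hl n); rewrite exprS; nra.
Qed.

(** A small hermitian [h] is the real part of the unitary [h + 'i (1 - x)], and
    the image of a unitary, being unitary, has norm at most 1. *)
Lemma star_hom_bounded a : cnorm (p a) <= 2 * cnorm a.
Proof.
have small h : star h = h -> cnorm h <= 2^-1 -> cnorm (p h) <= 1.
  move=> sh h2; have [x [sx hx xx]] := sqrt_one_minus_sqr sh h2.
  pose w := h + 'i *: (1 - x).
  have sw : star w = h - 'i *: (1 - x).
    by rewrite starD sh starZ starB star1 sx conjCi scaleNr.
  have ww : star w * w = 1.
    have hJ : h * ('i *: (1 - x)) = 'i *: (1 - x) * h.
      by rewrite -scalerAr -scalerAl mulrBr mulrBl mulr1 mul1r hx.
    have JJ : 'i *: (1 - x) * ('i *: (1 - x)) = - ((1 - x) * (1 - x)).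
      by rewrite -scalerAl -scalerAr scalerA -expr2 sqrCi scaleN1r.
    rewrite sw mulrDr 2![(h - _) * _]mulrBl hJ JJ opprK addrA subrK.
    rewrite mulrBl mul1r mulrBr mulr1 opprB addrACA -opprD xx.
    by rewrite opprD addrACA subrr addr0 addrC subrK.
  have -> : h = 2^-1 *: (w + star w).
    rewrite sw /w addrACA addrN addr0 -mulr2n -[h *+ 2]scaler_nat scalerA.
    by rewrite mulVf ?scale1r // pnatr_eq0.
  rewrite linearZ rmorphD /= cnormZ_half star_hom_star.
  have := cnormD (p w) (star (p w)); rewrite cnorm_star.
  have := star_hom_unitary ww; lra.
have herm h : star h = h -> cnorm (p h) <= 2 * cnorm h.
  move=> sh; have [h0|h0] := eqVneq (cnorm h) 0.
    by rewrite (cnorm_eq0 _ h0) linear0 !cnorm0 mulr0.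
  have hp : 0 < cnorm h by rewrite lt_def h0 cnorm_ge0.
  pose c := (2 * cnorm h)^-1.
  have c0 : 0 < c by rewrite invr_gt0 mulr_gt0 // ltr0n.
  have := small (c%:C%C *: h); rewrite starZ sh conj_Creal ?complex_real //.
  rewrite linearZ !cnormZr gtr0_norm //.
  have -> : c * cnorm h = 2^-1 by rewrite /c invfM mulfVK.
  by move=> /(_ erefl (lexx _)); rewrite -ler_pdivlMl // mulr1 invrK.
rewrite -(@ler_pXn2r _ 2) ?nnegrE ?mulr_ge0 ?cnorm_ge0 ?ler0n //.
rewrite -cstar_identity -star_hom_star -rmorphM.
apply: le_trans (herm _ _) _; first by rewrite starM starK.
rewrite cstar_identity exprMn ler_wpM2r ?sqr_ge0 //; lra.
Qed.

End Bounded.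

(** * Closed range *)

Section MakeStarHom.
Variables (R : realType) (A B : cstarType R) (f : A -> B).
Hypotheses (f_linear : linear f) (f1 : f 1 = 1).
Hypotheses (fM : {morph f : a b / a * b}).
Hypotheses (f_star : forall a, f (star a) = star (f a)).

Lemma star_hom_exists : exists phi : star_hom A B, phi =1 f.
Proof.
pose lin := GRing.isLinear.Build R[i] A B *:%R f f_linear.
pose mon := GRing.isMonoidMorphism.Build A B f (f1, fM).
pose F : {lrmorphism A -> B} := HB.pack f lin mon.
by exists (@StarHom R A B F f_star).
Qed.

End MakeStarHom.

Section ClosedRange.
Variables (R : realType) (A B : cstarType R) (p : star_hom A B).

(** [h] may be much larger than its image. Replacing it by [h / (1 + h^2)], after
    scaling so that the image has norm [1 / 4], makes it of bounded norm and
    changes its image only by the cube of that norm. *)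
Lemma hermitian_lift (h : A) : star h = h ->
  exists h', cnorm h' <= 4 * cnorm (p h) /\
             cnorm (p h' - p h) <= 16^-1 * cnorm (p h).
Proof.
move=> sh; have [t0|t0] := eqVneq (cnorm (p h)) 0.
  exists 0; rewrite cnorm0 t0 !mulr0 lexx; split=> //.
  by rewrite linear0 sub0r cnormN t0.
have tp : 0 < cnorm (p h) by rewrite lt_def t0 cnorm_ge0.
set t := cnorm (p h) in t0 tp *.
have t4 : 0 < 4 * t by rewrite mulr_gt0 // ltr0n.
pose c : R := (4 * t)^-1.
have c0 : 0 < c by rewrite invr_gt0.
pose C : R[i] := c%:C%C; pose D : R[i] := (4 * t)%:C%C.
have DC : D * C = 1 by rewrite -rmorphM divff ?gt_eqF.
have sa : star (C *: h) = C *: h by rewrite starZ sh conj_Creal ?complex_real.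
have [r rr] := hermitian_resolvent sa.
have rn := resolvent_norm sa rr.
exists (D *: (2^-1 *: (r + star r))); split.
  rewrite cnormZr gtr0_norm // ler_piMr ?(ltW t4) // cnormZ_half.
  by have := cnormD r (star r); rewrite cnorm_star; lra.
have spa : star (p (C *: h)) = p (C *: h) by rewrite -star_hom_star sa.
have := resolvent_real_part spa (star_hom_resolvent p rr).
rewrite -star_hom_star.
have E : 2^-1 *: (p r + p (star r)) - p (C *: h) = p (2^-1 *: (r + star r) - C *: h).
  by rewrite rmorphB /= [p (2^-1 *: _)]linearZ rmorphD /=.
rewrite E [p (C *: h)]linearZ /= cnormZr gtr0_norm // -/t => le.
have -> : p (D *: (2^-1 *: (r + star r))) - p h = D *: p (2^-1 *: (r + star r) - C *: h).
  have hE : h = D *: (C *: h) by rewrite scalerA DC scale1r.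
  by rewrite [X in _ - p X]hE -rmorphB -scalerBr /= linearZ.
rewrite cnormZr gtr0_norm //.
have -> : 16^-1 * t = 4 * t * (c * t) ^+ 3.
  by rewrite /c; field.
by rewrite ler_pM2l.
Qed.

(** The same for any [a], through its real and imaginary parts. *)
Lemma approximate_lift (a : A) :
  exists a', cnorm a' <= 8 * cnorm (p a) /\
             cnorm (p a' - p a) <= 8^-1 * cnorm (p a).
Proof.
pose h := 2^-1 *: (a + star a); pose k := 2^-1 *: (- 'i *: (a - star a)).
have conj2 : Num.conj (2^-1 : R[i]) = 2^-1 by rewrite fmorphV rmorph_nat.
have sh : star h = h by rewrite /h starZ starD starK addrC conj2.
have sk : star k = k.
  by rewrite /k !starZ starB starK conj2 rmorphN /= conjCi opprK -opprB scalerN scaleNr.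
have aE : a = h + 'i *: k.
  rewrite /h /k scalerA mulrC -scalerA -scalerDr scalerA mulrN -expr2 sqrCi opprK scale1r.
  rewrite addrACA addrN addr0 -mulr2n -[a *+ 2]scaler_nat scalerA.
  by rewrite mulVf ?scale1r // pnatr_eq0.
have star_pa : cnorm (p (star a)) = cnorm (p a) by rewrite star_hom_star cnorm_star.
have ph : cnorm (p h) <= cnorm (p a).
  rewrite /h linearZ cnormZ_half rmorphD /=.
  by have := cnormD (p a) (p (star a)); rewrite star_pa; lra.
have pk : cnorm (p k) <= cnorm (p a).
  rewrite /k linearZ cnormZ_half linearZ /= cnormZ1 ?normrN ?normCi // rmorphB /=.
  by have := cnormB (p a) (p (star a)); rewrite star_pa; lra.
have [h' [h1 h2]] := hermitian_lift sh.
have [k' [k1 k2]] := hermitian_lift sk.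
exists (h' + 'i *: k'); split.
  have := cnormD h' ('i *: k'); rewrite cnormZ1 ?normCi //; lra.
have -> : p (h' + 'i *: k') - p a = (p h' - p h) + 'i *: (p k' - p k).
  by rewrite {1}aE !rmorphD /= ![p ('i *: _)]linearZ /= scalerBr opprD addrACA.
apply: le_trans (cnormD _ _) _; rewrite cnormZ1 ?normCi //; lra.
Qed.

(** As in the open mapping theorem: an adherent [b] is approximated by the image
    of an element of norm at most [9 |b|] with error at most [|b| / 2], and the
    corrections obtained by iterating on the error have a convergent sum. *)
Lemma star_hom_closed_range (b : B) :
  (forall eps : R, 0 < eps -> exists a, cnorm (p a - b) < eps) ->
  exists a, p a = b.
Proof.
pose adherent b := forall eps : R, 0 < eps -> exists a, cnorm (p a - b) < eps.
rewrite -/(adherent b) => hb.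
have lift c : exists a, adherent c ->
    cnorm a <= 9 * cnorm c /\ cnorm (c - p a) <= 2^-1 * cnorm c.
  have [hc|nc] := pselect (adherent c); last by exists 0 => /nc.
  have [c0|c0] := eqVneq (cnorm c) 0.
    exists 0 => _; rewrite linear0 subr0 cnorm0 c0 !mulr0; split; lra.
  have cp : 0 < cnorm c by rewrite lt_def c0 cnorm_ge0.
  have [|a ha] := hc (8^-1 * cnorm c); first by rewrite mulr_gt0 ?invr_gt0 ?ltr0n.
  have [a' [h1 h2]] := approximate_lift a; exists a' => _.
  have := cnormD (p a - c) c; rewrite subrK => h3.
  split; first lra.
  by have := cnorm_dist_trans (p a) (p a') c; rewrite [in X in _ -> X]cnorm_distC; lra.
have [g hg] := choice lift.
pose x := fix x n := if n is n'.+1 then x n' + g (b - p (x n')) else 0.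
have adh n : adherent (b - p (x n)).
  move=> eps /hb [a ha]; exists (a - x n).
  by rewrite rmorphB /= opprB addrA subrK.
have bn n : cnorm (b - p (x n)) <= cnorm b * 2^-1 ^+ n.
  elim: n => [|n IH]; first by rewrite /= linear0 subr0 expr0 mulr1.
  have [_] := hg _ (adh n); rewrite /= rmorphD /= opprD addrA => /le_trans; apply.
  by rewrite exprS mulrCA ler_pM2l ?invr_gt0 ?ltr0n.
have hq : 0 <= (2^-1 : R) < 1 by apply/andP; split; lra.
have [||l hl] := @geometric_limit R A 2^-1 (9 * cnorm b) x hq.
- by rewrite mulr_ge0 ?cnorm_ge0.
- move=> n; rewrite /= addrAC subrr add0r -mulrA.
  by have [h _] := hg _ (adh n); apply: le_trans h _; rewrite ler_pM2l ?bn.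
move: (_ / _) hl => K hl.
exists l; apply/eqP; rewrite -subr_eq0; apply/eqP.
apply: (@cnorm_geometric_eq0 R B 2^-1 (2 * K + cnorm b) _ hq) => n.
apply: le_trans (cnorm_dist_trans (p (x n)) _ _) _; rewrite mulrDl lerD //.
  rewrite -rmorphB; apply: le_trans (star_hom_bounded _ _) _.
  by rewrite -mulrA ler_pM2l.
by rewrite cnorm_distC.
Qed.

End ClosedRange.

Section RangeAlgebra.
Variables (R : realType) (A B : cstarType R) (p : star_hom A B).

Definition range_pred : {pred B} := fun b => `[< exists a, p a = b >].

Lemma range_predP b : reflect (exists a, p a = b) (b \in range_pred).
Proof. exact: asboolP. Qed.

Lemma range_subalg_closed : subalg_closed range_pred.
Proof.
split=> [|z b c|b c]; first by apply/range_predP; exists 1; rewrite rmorph1.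
- move=> /range_predP[a <-] /range_predP[a' <-]; apply/range_predP.
  by exists (z *: a + a'); rewrite linearP.
- move=> /range_predP[a <-] /range_predP[a' <-]; apply/range_predP.
  by exists (a * a'); rewrite rmorphM.
Qed.

HB.instance Definition _ :=
  GRing.isSubalgClosed.Build R[i] B range_pred range_subalg_closed.

(** The range is a C*-algebra, complete because it is closed. *)
Record range_alg := RangeAlg { range_val : B; _ : range_val \in range_pred }.

HB.instance Definition _ := [isSub for range_val].
HB.instance Definition _ := [Choice of range_alg by <:].
HB.instance Definition _ := [SubChoice_isSubAlgebra of range_alg by <:].

Lemma range_star b : b \in range_pred -> star b \in range_pred.
Proof.
by move=> /range_predP[a <-]; apply/range_predP; exists (star a); rewrite star_hom_star.
Qed.

Definition range_alg_star (b : range_alg) : range_alg :=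
  RangeAlg (range_star (valP b)).

Lemma range_complete (a : nat -> range_alg) :
  (forall eps : R, 0 < eps -> exists N : nat, forall m n : nat,
     (N <= m)%N -> (N <= n)%N -> cnorm (val (a m - a n)) < eps) ->
  exists l : range_alg, forall eps : R, 0 < eps -> exists N : nat, forall n : nat,
     (N <= n)%N -> cnorm (val (a n - l)) < eps.
Proof.
move=> ca; have [l hl] := @cnorm_complete R B (fun n => val (a n)) ca.
have rl : l \in range_pred.
  apply/range_predP; apply: star_hom_closed_range => eps /hl[N HN].
  by have /range_predP[x hx] := valP (a N); exists x; rewrite hx; exact: HN.
by exists (RangeAlg rl).
Qed.

HB.instance Definition _ := isCStarAlgebra.Build R range_alg
  (fun b h => val_inj (cnorm_eq0 (val b) h : val b = val (0 : range_alg)))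
  (fun b c => cnormD (val b) (val c))
  (fun z b => cnormZ z (val b))
  (fun b c => cnormM (val b) (val c))
  range_complete
  (fun b => val_inj (starK (val b) : val (range_alg_star (range_alg_star b)) = val b))
  (fun b c => val_inj (starD (val b) (val c) :
     val (range_alg_star (b + c)) = val (range_alg_star b + range_alg_star c)))
  (fun z b => val_inj (starZ z (val b) :
     val (range_alg_star (z *: b)) = val (Num.conj z *: range_alg_star b)))
  (fun b c => val_inj (starM (val b) (val c) :
     val (range_alg_star (b * c)) = val (range_alg_star c * range_alg_star b)))
  (fun b => cstar_identity (val b)).

Lemma range_inclusion : exists phi : star_hom range_alg B, phi =1 val.
Proof. exact: star_hom_exists. Qed.

End RangeAlgebra.

(** * Homomorphisms between tensor products *)

Section DenseExtension.
(** The homomorphism on the dense subalgebra is given by its graph [Q]: it is not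
    known to be well defined beforehand, which follows from contractivity. *)
Variables (R : realType) (A B : cstarType R) (Q : A -> B -> Prop).
Hypotheses (Q_linear : forall (z : R[i]) a b a' b',
              Q a b -> Q a' b' -> Q (z *: a + a') (z *: b + b'))
           (Q1 : Q 1 1)
           (QM : forall a b a' b', Q a b -> Q a' b' -> Q (a * a') (b * b'))
           (Q_star : forall a b, Q a b -> Q (star a) (star b))
           (Q_contractive : forall a b, Q a b -> cnorm b <= cnorm a)
           (Q_dense : forall (a : A) (eps : R), 0 < eps ->
              exists a' b', Q a' b' /\ cnorm (a - a') < eps).

Let approx (a : A) (b : B) := forall eps : R, 0 < eps ->
  exists a' b', [/\ Q a' b', cnorm (a - a') < eps & cnorm (b - b') < eps].

Lemma dense_Q_sub a b a' b' : Q a b -> Q a' b' -> Q (a - a') (b - b').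
Proof.
move=> h h'; have := Q_linear (-1) h' h.
by rewrite !scaleN1r ![- _ + _]addrC.
Qed.

Lemma approx_contractive a b : approx a b -> cnorm b <= cnorm a.
Proof.
move=> ab.
suff le (eps : R) : 0 < eps -> cnorm b <= cnorm a + eps by exact/ler_addgt0Pr.
move=> e0; have e2 : 0 < eps / 2 by rewrite divr_gt0.
have [a' [b' [/Q_contractive h ha hb]]] := ab _ e2.
have := cnormD (b - b') b'; have := cnormD (a' - a) a.
by rewrite !subrK (cnorm_distC a'); lra.
Qed.

Lemma approx_total a : exists b, approx a b.
Proof.
have pos n : 0 < (2^-1 : R) ^+ n by rewrite exprn_gt0 // invr_gt0.
have D n : exists ab, Q ab.1 ab.2 /\ cnorm (a - ab.1) < 2^-1 ^+ n.
  by have [a' [b' h]] := Q_dense a (pos n); exists (a', b').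
have [s hs] := choice D.
have hq : 0 <= (2^-1 : R) < 1 by apply/andP; split; lra.
have [|n|l hl] := @geometric_limit R B 2^-1 2 (fun n => (s n).2) hq.
- lra.
- have [h1 h2] := hs n; have [h3 h4] := hs n.+1.
  apply: le_trans (Q_contractive (dense_Q_sub h3 h1)) _.
  apply: le_trans (cnorm_dist_trans a _ _) _.
  move: h4 (pos n); rewrite (cnorm_distC a) exprS; lra.
exists l => eps e0.
have [N1 /(_ _ (leq_maxl N1 _)) H1] := geometric_small 1 hq e0.
have [N2 H2] := geometric_small (2 / (1 - 2^-1)) hq e0.
set n := maxn N1 N2.
have [h1 h2] := hs n; exists (s n).1, (s n).2; split=> //.
- by apply: lt_trans h2 _; have := H1 N2; rewrite mul1r.
- by apply: le_lt_trans (hl n) (H2 _ (leq_maxr _ _)).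
Qed.

Lemma approx_linear z a b a' b' :
  approx a b -> approx a' b' -> approx (z *: a + a') (z *: b + b').
Proof.
move=> h h' eps e0.
have zE (D : cstarType R) (d : D) : cnorm (z *: d) = complex.Re `|z| * cnorm d.
  have := congr1 (@complex.Re R) (cnormZ z d).
  by rewrite normc_def /= mul0r subr0.
have K0 : 0 <= complex.Re `|z| by rewrite normc_def /= sqrtr_ge0.
set K := complex.Re `|z| in zE K0.
pose d := eps / (2 * (K + 1)).
have d0 : 0 < d by rewrite divr_gt0 // mulr_gt0 // ltr_wpDl.
have Kd : K * d < eps / 2.
  rewrite /d mulrA ltr_pdivrMr ?mulr_gt0 // ?ltr_wpDl //; nra.
have e2 : 0 < eps / 2 by rewrite divr_gt0.
have [x [y [qx hx hy]]] := h _ d0.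
have [x' [y' [qx' hx' hy']]] := h' _ e2.
exists (z *: x + x'), (z *: y + y'); split; first exact: Q_linear.
- rewrite opprD addrACA -scalerBr; apply: le_lt_trans (cnormD _ _) _.
  by rewrite zE; move: (cnorm (a - x)) hx => ?; nra.
- rewrite opprD addrACA -scalerBr; apply: le_lt_trans (cnormD _ _) _.
  by rewrite zE; move: (cnorm (b - y)) hy => ?; nra.
Qed.

Lemma approx_mul a b a' b' :
  approx a b -> approx a' b' -> approx (a * a') (b * b').
Proof.
move=> h h' eps e0.
pose M := cnorm a + cnorm a' + cnorm b + cnorm b' + 2.
have M0 : 2 <= M by rewrite lerDr !addr_ge0 ?cnorm_ge0.
pose d := Num.min 1 (eps / M).
have d0 : 0 < d by rewrite lt_min ltr01 divr_gt0 //; lra.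
have dM : d * M <= eps by rewrite -ler_pdivlMr ?ge_min ?lexx ?orbT //; lra.
have d1 : d <= 1 by rewrite ge_min lexx.
have bound (D : cstarType R) (x y x' y' : D) : cnorm (x - x') < d ->
    cnorm (y - y') < d -> cnorm x + cnorm y + 2 <= M -> cnorm (x * y - x' * y') < eps.
  move=> hx hy le.
  have -> : x * y - x' * y' = x * (y - y') + (x - x') * y'.
    by rewrite mulrBr mulrBl addrA subrK.
  apply: le_lt_trans (cnormD _ _) _.
  have := cnormM x (y - y'); have := cnormM (x - x') y'.
  have := cnormD (y' - y) y; rewrite subrK cnorm_distC.
  have := cnorm_ge0 x; have := cnorm_ge0 y'; have := cnorm_ge0 y.
  have := cnorm_ge0 (x - x'); have := cnorm_ge0 (y - y').
  move: (cnorm (x - x')) hx (cnorm (y - y')) hy (cnorm (x * _)) (cnorm (_ * y')) => s hs t ht v w s0 t0 y0 y'0 x0 hy' hw hv.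
  have B1 : v <= cnorm x * d by apply: le_trans hv _; rewrite ler_wpM2l // ltW.
  have B2 : w <= d * (cnorm y + 1).
    apply: le_trans hw _; apply: ler_pM => //; first exact: ltW.
    by lra.
  apply: lt_le_trans dM; nra.
have [x [y [qx hx hy]]] := h _ d0.
have [x' [y' [qx' hx' hy']]] := h' _ d0.
exists (x * x'), (y * y'); split; first exact: QM.
- apply: bound => //; rewrite lerD2r /M.
  by have := cnorm_ge0 b; have := cnorm_ge0 b'; lra.
- apply: bound => //; rewrite lerD2r /M.
  by have := cnorm_ge0 a; have := cnorm_ge0 a'; lra.
Qed.

Lemma approx_star a b : approx a b -> approx (star a) (star b).
Proof.
move=> h eps /h [x [y [qx hx hy]]]; exists (star x), (star y).
by split; [exact: Q_star|rewrite -starB cnorm_star|rewrite -starB cnorm_star].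
Qed.

Lemma approx_functional a b b' : approx a b -> approx a b' -> b = b'.
Proof.
move=> h h'; have := approx_contractive (approx_linear (-1) h' h).
rewrite !scaleN1r addNr cnorm0 => le; apply/esym/eqP; rewrite -subr_eq0.
rewrite -oppr_eq0 opprB addrC; apply/eqP/cnorm_eq0/eqP.
by rewrite eq_le le cnorm_ge0.
Qed.

Lemma approx_Q a b : Q a b -> approx a b.
Proof.
by move=> q eps e0; exists a, b; split=> //; rewrite subrr cnorm0.
Qed.

Lemma dense_extension : exists phi : star_hom A B, forall a b, Q a b -> phi a = b.
Proof.
have [f hf] := choice approx_total.
have fE a b : approx a b -> f a = b by apply: approx_functional.
have [phi phiE] : exists phi : star_hom A B, phi =1 f.
  apply: star_hom_exists.
  - by move=> z a a'; apply: fE; apply: approx_linear.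
  - by apply: fE; exact: approx_Q.
  - by move=> a a'; apply: fE; apply: approx_mul.
  - by move=> a; apply: fE; apply: approx_star.
by exists phi => a b /approx_Q/fE <-.
Qed.

End DenseExtension.

Section TensorMap.
Variables (R : realType) (A B : cstarType R) (p : star_hom A B).
Variables (D : min_tensor A A) (E : min_tensor B B).

Lemma representation_comp (H : hilbertType R) (rho : representation B H) :
  exists sigma : representation A H, forall a, sigma a = rho (p a).
Proof.
have c (a : A) : continuous (rho (p a)) by exact: rep_bounded.
have l (z : R[i]) (a b : A) (x : H) :
    rho (p (z *: a + b)) x = z *: rho (p a) x + rho (p b) x.
  by rewrite linearP rep_linear.
have o (x : H) : rho (p 1) x = x by rewrite rmorph1 rep_one.
have m (a b : A) (x : H) : rho (p (a * b)) x = rho (p a) (rho (p b) x).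
  by rewrite rmorphM rep_mul.
have s (a : A) (x y : H) : dot (rho (p (star a)) x) y = dot x (rho (p a) y).
  by rewrite star_hom_star rep_star.
by exists (@Representation R A H (fun a => rho (p a)) c l o m s).
Qed.

(** Composing with [p] turns representations of [B] into representations of [A],
    so the supremum defining the norm on the side of [B] is over fewer pairs. *)
Lemma spatial_norm_le_map (t : seq (A * A)) (c : R) : spatial_norm_le t c ->
  spatial_norm_le [seq (p q.1, p q.2) | q <- t] c.
Proof.
move=> h H K rho sigma s.
have [rho' hr] := representation_comp rho.
have [sigma' hs] := representation_comp sigma.
have := h H K rho' sigma' s.
congr (tensor_sqnorm _ <= _).
rewrite /tensor_act allpairs_mapl; apply: eq_allpairs => x y /=.
by rewrite hr hs.
Qed.

Lemma tensorM (F : cstarType R) (G : min_tensor F F) a b a' b' :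
  tensor G a b * tensor G a' b' = tensor G (a * a') (b * b').
Proof.
rewrite /tensor !rmorphM -!mulrA; congr (_ * _).
by rewrite !mulrA -tensor_comm.
Qed.

Lemma tensor_star (F : cstarType R) (G : min_tensor F F) a b :
  star (tensor G a b) = tensor G (star a) (star b).
Proof. by rewrite /tensor starM -!star_hom_star -tensor_comm. Qed.

Lemma tensorZ (F : cstarType R) (G : min_tensor F F) z a b :
  z *: tensor G a b = tensor G (z *: a) b.
Proof. by rewrite /tensor linearZ scalerAl. Qed.

Lemma tensor11 (F : cstarType R) (G : min_tensor F F) : tensor G 1 1 = 1.
Proof. by rewrite /tensor !rmorph1 mulr1. Qed.

(** The map sending the sum of the [a (x) b] to the sum of the [p a (x) p b] is
    contractive for the spatial norms, so it extends to the completions. *)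
Lemma tensor_map : exists pp : star_hom D E, forall a b,
  pp (tensor D a b) = tensor E (p a) (p b).
Proof.
pose Q (d : D) (e : E) := exists t : seq (A * A),
  d = \sum_(q <- t) tensor D q.1 q.2 /\
  e = \sum_(q <- t) tensor E (p q.1) (p q.2).
have [pp hpp] : exists phi : star_hom D E, forall d e, Q d e -> phi d = e.
  apply: dense_extension.
  - move=> z _ _ _ _ [t [-> ->]] [t' [-> ->]].
    exists ([seq (z *: q.1, q.2) | q <- t] ++ t').
    rewrite !big_cat !big_map /= !scaler_sumr.
    by split; congr (_ + _); apply: eq_bigr => q _; rewrite ?linearZ tensorZ.
  - by exists [:: (1, 1)]; rewrite !big_seq1 /= !rmorph1 !tensor11.
  - move=> _ _ _ _ [t [-> ->]] [t' [-> ->]].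
    exists [seq (q.1 * q'.1, q.2 * q'.2) | q <- t, q' <- t'].
    rewrite !big_allpairs_dep /= !mulr_suml; split;
      apply: eq_bigr => q _; rewrite mulr_sumr;
      by apply: eq_bigr => q' _; rewrite tensorM ?rmorphM.
  - move=> _ _ [t [-> ->]]; exists [seq (star q.1, star q.2) | q <- t].
    rewrite !big_map !star_sum /=.
    by split; apply: eq_bigr => q _; rewrite tensor_star ?star_hom_star.
  - move=> _ _ [t [-> ->]].
    have /(tensor_norm D t (cnorm_ge0 _)) h := lexx (cnorm (\sum_(q <- t) tensor D q.1 q.2)).
    have /(tensor_norm E _ (cnorm_ge0 _)) := spatial_norm_le_map h.
    by rewrite big_map.
  - move=> d eps /(tensor_dense d) [t ht].
    by do 2!eexists; split; [exists t; split|].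
by exists pp => a b; apply: hpp; exists [:: (a, b)]; rewrite !big_seq1.
Qed.

End TensorMap.

(** * Quantum subgroups of quantum automorphism groups *)

Section Qaut.
Variables (R : realType).

Lemma qaut_relations_map (V : finType) (e : rel V) (A B : cstarType R)
    (p : star_hom A B) (u : V -> V -> A) :
  qaut_relations e u -> qaut_relations e (fun x y => p (u x y)).
Proof.
case=> proj sum comm; split=> [x y|x|x y].
- have [h1 h2] := proj x y; split; first by rewrite -star_hom_star -h1.
  by rewrite -rmorphXn -h2.
- have [h1 h2] := sum x.
  by split; rewrite -rmorph_sum ?h1 ?h2 rmorph1.
- have := congr1 p (comm x y); rewrite !rmorph_sum /= => h.
  rewrite (eq_bigr (fun z => p (u x z * (e z y)%:R))) => [|z _].
    by rewrite h; apply: eq_bigr => z _; rewrite rmorphM /= rmorph_nat.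
  by rewrite rmorphM /= rmorph_nat.
Qed.

Lemma qaut_relations_reflect (V : finType) (e : rel V) (A B : cstarType R)
    (p : star_hom A B) (u : V -> V -> A) : injective p ->
  qaut_relations e (fun x y => p (u x y)) -> qaut_relations e u.
Proof.
move=> pI [proj sum comm]; split=> [x y|x|x y].
- by have [h1 h2] := proj x y; split; apply: pI; rewrite ?star_hom_star ?rmorphXn.
- by have [h1 h2] := sum x; split; apply: pI; rewrite rmorph_sum rmorph1.
- apply: pI; rewrite !rmorph_sum; have := comm x y.
  under eq_bigr do rewrite -[X in _ * X](rmorph_nat p) -rmorphM.
  move=> ->; apply: eq_bigr => z _.
  by rewrite [RHS]rmorphM /= rmorph_nat.
Qed.

(** The range of [p] is a C*-algebra containing the generators, hence by
    universality the target of a homomorphism [f] fixing them. Followed by the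
    inclusion, [f] is the identity, so the inclusion is onto. *)
Lemma qaut_surjective (V : finType) (e : rel V) (A B : cstarType R)
    (u : V -> V -> A) (p : star_hom B A) : qaut_universal e u ->
  (forall x y, exists b, p b = u x y) -> forall a, exists b, p b = a.
Proof.
move=> [urel uni] hp.
have ur x y : u x y \in range_pred p by apply/range_predP.
have [incl inclE] := range_inclusion p.
pose v x y : range_alg p := RangeAlg (ur x y).
have vrel : qaut_relations e v.
  apply: (@qaut_relations_reflect _ _ _ _ incl).
    by move=> a b; rewrite !inclE; exact: val_inj.
  suff -> : (fun x y => incl (v x y)) = u by [].
  by apply/funext => x; apply/funext => y; rewrite inclE.
have [[f fu] _] := uni _ v vrel.
have [_ unique] := uni _ u urel.
have [g gE] : exists g : star_hom A A, g =1 incl \o f.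
  apply: star_hom_exists.
  - by move=> z a b; rewrite /= !linearP.
  - by rewrite /= !rmorph1.
  - by move=> a b; rewrite /= !rmorphM.
  - by move=> a; rewrite /= !star_hom_star.
have [i iE] : exists i : star_hom A A, i =1 id by apply: star_hom_exists.
have gi : g =1 i.
  by apply: unique => x y; rewrite ?iE // gE /= fu inclE.
by move=> a; apply/range_predP; rewrite -(iE a) -gi gE /= inclE; exact: valP.
Qed.

(** The surjection is the homomorphism given by the universal property of [G]. It
    intertwines the comultiplications because two homomorphisms that agree on the
    generators of [qalg G] are equal. *)
Lemma quantum_subgroup_of_magic_unitary (V W : finType) (e : rel V) (f : rel W)
    (H G : qgroup R) (u : V -> V -> qalg H) (v : W -> W -> qalg H) :
  qaut_universal e u -> is_qaut f G -> qaut_relations f v ->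
  (forall i j, qcomult H (v i j) = \sum_k tensor (qtensor H) (v i k) (v k j)) ->
  (forall x y, exists i j, v i j = u x y) ->
  quantum_subgroup H G.
Proof.
move=> uuni [U [[Urel Uuni] UD]] vrel vD entries.
have [[p pU] _] := Uuni _ v vrel.
have [pp ppE] := tensor_map p (qtensor G) (qtensor H).
exists p, pp; split=> //.
- apply: (qaut_surjective uuni) => x y; have [i [j <-]] := entries x y.
  by exists (U i j).
- have [l lE] : exists l : star_hom (qalg G) (qtensor H), l =1 qcomult H \o p.
    apply: star_hom_exists.
    - by move=> z a b; rewrite /= !linearP.
    - by rewrite /= !rmorph1.
    - by move=> a b; rewrite /= !rmorphM.
    - by move=> a; rewrite /= !star_hom_star.
  have [r rE] : exists r : star_hom (qalg G) (qtensor H), r =1 pp \o qcomult G.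
    apply: star_hom_exists.
    - by move=> z a b; rewrite /= !linearP.
    - by rewrite /= !rmorph1.
    - by move=> a b; rewrite /= !rmorphM.
    - by move=> a; rewrite /= !star_hom_star.
  have [_ unique] := Uuni _ _ (qaut_relations_map l Urel).
  move=> a; have := @unique l r (fun _ _ => erefl) _ a.
  rewrite lE rE /=; apply=> x y.
  rewrite lE rE /= UD rmorph_sum /= pU vD; apply: eq_bigr => z _.
  by rewrite ppE !pU.
Qed.

(** The vertex [m] may have neighbours outside the range of [s]. *)
Definition leaf_set_at (W : finType) (f : rel W) (m : W) (V : finType) (s : V -> W) :=
  [/\ injective s, forall x, s x != m,
      forall x j, f (s x) j = (j == m) & forall x j, f j (s x) = (j == m)].

(** Let [u] act on the leaves and let the other vertices be fixed. As all leaves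
    have the neighbour [m] and no other, the commutation relation of the block
    matrix [v] at a leaf amounts to the rows and columns of [u] summing to 1. *)
Lemma qaut_subgroup_of_leaves (V W : finType) (e : rel V) (f : rel W)
    (m : W) (s : V -> W) :
  leaf_set_at f m s -> qaut_subgroup R e f.
Proof.
move=> [sI sm fl fr] H G [u [uuni uD]] Gq.
have [proj sum comm] := uuni.1.
pose t (i : W) : option V := [pick x | s x == i].
have ts x : t (s x) = Some x.
  rewrite /t; case: pickP => [y /eqP/sI -> //|/(_ x)]; by rewrite eqxx.
have tN i x : t i = Some x -> i = s x.
  by rewrite /t; case: pickP => // y /eqP <- [->].
have tm : t m = None.
  by case E: (t m) => [x|] //; move/tN: E (sm x) => ->; rewrite eqxx.
pose v (i j : W) : qalg H :=
  match t i, t j with Some x, Some y => u x y | _, _ => (i == j)%:R end.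
have vs x y : v (s x) (s y) = u x y by rewrite /v !ts.
have vl i j : t i = None -> v i j = (i == j)%:R by rewrite /v => ->.
have vr i j : t j = None -> v i j = (i == j)%:R by rewrite /v => ->; case: (t i).
have split_sum (D : nmodType) (F : W -> D) :
    \sum_i F i = \sum_x F (s x) + \sum_(i | i \notin [set s x | x in V]) F i.
  rewrite (bigID (mem [set s x | x in V])) /=; congr (_ + _).
  by rewrite big_imset //= => x y _ _ /sI.
have leafP i : t i = None \/ exists x, i = s x.
  by case E: (t i) => [x|]; [right; exists x; exact: tN|left].
have notleaf i : i \notin [set s x | x in V] -> t i = None.
  by case: (leafP i) => // -[x ->]; rewrite imset_f.
have neq x i : t i = None -> (s x == i) = false.
  by move=> ti; apply/eqP => si; rewrite -si ts in ti.
have delta_suml (D : pzRingType) i (F : W -> D) : \sum_z (i == z)%:R * F z = F i.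
  rewrite (bigD1 i) //= eqxx mul1r big1 ?addr0 // => z.
  by rewrite eq_sym => /negbTE ->; rewrite mul0r.
have delta_sumr (D : pzRingType) j (F : W -> D) : \sum_z F z * (z == j)%:R = F j.
  rewrite (bigD1 j) //= eqxx mulr1 big1 ?addr0 // => z.
  by move=> /negbTE ->; rewrite mulr0.
apply: (quantum_subgroup_of_magic_unitary uuni Gq (v := v)); first split.
- move=> i j; rewrite /v; case: (t i) => [x|]; first case: (t j) => [y|].
  + exact: proj.
  + by case: (i == j); rewrite ?star0 ?star1 ?expr1n ?expr0n.
  + by case: (i == j); rewrite ?star0 ?star1 ?expr1n ?expr0n.
- move=> i; have [ti|[x ->]] := leafP i; split.
  + under eq_bigr do rewrite vl // -[_%:R]mulr1.
    exact: delta_suml.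
  + under eq_bigr do rewrite vr // -[_%:R]mul1r.
    exact: delta_sumr.
  + rewrite split_sum [X in _ + X]big1 => [|j /notleaf tj]; last by rewrite vr // neq.
    by rewrite addr0 -(sum x).1; apply: eq_bigr => y _; rewrite vs.
  + rewrite split_sum [X in _ + X]big1 => [|j /notleaf tj]; last by rewrite vl // eq_sym neq.
    by rewrite addr0 -(sum x).2; apply: eq_bigr => y _; rewrite vs.
- move=> i j; have [ti|[x ->]] := leafP i.
    under eq_bigr do rewrite vl //.
    rewrite delta_suml; have [tj|[y ->]] := leafP j.
      by under [RHS]eq_bigr do rewrite vr //; rewrite delta_sumr.
    rewrite [RHS]split_sum [X in _ + X]big1 => [|z /notleaf tz]; last first.
      by rewrite vl // eq_sym neq ?mulr0.
    under eq_bigr do rewrite vs fr.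
    by rewrite addr0 -mulr_sumr (sum y).2 mulr1 fr.
  rewrite split_sum [X in _ + X]big1 => [|z /notleaf tz]; last by rewrite vr // neq ?mul0r.
  under eq_bigr do rewrite vs fl.
  rewrite addr0 -mulr_suml (sum x).1 mul1r.
  under [RHS]eq_bigr do rewrite fl eq_sym.
  by rewrite delta_suml vl // eq_sym.
- have t0l a : tensor (qtensor H) 0 a = 0 by rewrite /tensor linear0 mul0r.
  have t0r a : tensor (qtensor H) a 0 = 0 by rewrite /tensor linear0 mulr0.
  move=> i j; have [ti|[x ->]] := leafP i.
    rewrite vl // rmorph_nat (bigD1 i) //= big1 => [|k]; last first.
      by rewrite eq_sym vl // => /negbTE ->; rewrite t0l.
    rewrite addr0 !vl // eqxx.
    by case: (i == j); rewrite ?tensor11 ?t0r.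
  rewrite split_sum [X in _ + X]big1 => [|k /notleaf tk]; last by rewrite vr // neq ?t0l.
  rewrite addr0; have [tj|[y ->]] := leafP j.
    by rewrite vr // neq // linear0 big1 // => k _; rewrite [v (s k) j]vr // neq // t0r.
  by rewrite vs uD; apply: eq_bigr => z _; rewrite !vs.
- by move=> x y; exists (s x), (s y).
Qed.

End Qaut.

(** * Almost all trees *)

Local Close Scope ring_scope.

Section AlmostAll.
Variables (R : realType) (V : finType) (P : rel V).

Lemma qaut_subgroup_of_not_sparse (T : finType) (r : T) (e : rel T)
    (f : {ffun T -> T}) : rooted r f -> e =2 tree_of f -> ~~ sparse r V f ->
  qaut_subgroup R P e.
Proof.
move=> rf ef; rewrite /sparse rf negb_forall => /existsP[z]; rewrite -leqNgt => kz.
pose s (v : V) := nth z (enum (leaves f z)) (enum_rank v).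
have bound (v : V) : enum_rank v < size (enum (leaves f z)).
  by rewrite -cardE; apply: leq_trans (ltn_ord _) kz.
have sP v : leaf f (s v) /\ f (s v) = z.
  have : s v \in leaves f z by rewrite -mem_enum mem_nth.
  by rewrite inE => /andP[? /eqP].
apply: (@qaut_subgroup_of_leaves R V T P e z s); split.
- move=> v w /eqP; rewrite nth_uniq ?enum_uniq // => /eqP/val_inj; exact: enum_rank_inj.
- by move=> v; have [/forallP/(_ (s v)) + fs] := sP v; rewrite fs eq_sym.
- by move=> v j; rewrite ef leaf_tree_of ?(sP v).2 //; case: (sP v).
- by move=> v j; rewrite ef tree_of_sym leaf_tree_of ?(sP v).2 //; case: (sP v).
Qed.

Definition tree_code n (f : {ffun 'I_n -> 'I_n}) : labelled_rel n :=
  [ffun p => tree_of f p.1 p.2].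

Lemma rel_of_tree_code n (f : {ffun 'I_n -> 'I_n}) :
  rel_of (tree_code f) = tree_of f.
Proof.
by apply/funext => x; apply/funext => y; rewrite /rel_of ffunE.
Qed.

Lemma card_rooted_le n :
  #|[set f : {ffun 'I_n.+1 -> 'I_n.+1} | rooted ord0 f]| <= #|labelled_trees n.+1|.
Proof.
rewrite -(card_in_imset (f := @tree_code n.+1)).
  apply: subset_leq_card; apply/fintype.subsetP => _ /imsetP[f + ->].
  rewrite inE => rf; rewrite inE; apply/asboolP; rewrite rel_of_tree_code.
  exact: tree_of_is_tree rf.
move=> f g; rewrite !inE => rf rg fg; apply: tree_of_inj rf rg _ => x y.
by rewrite -!rel_of_tree_code fg.
Qed.

Lemma card_bad_trees_le n (Q : rel 'I_n.+1 -> Prop) :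
  (forall f e, rooted ord0 f -> e =2 tree_of f -> ~~ sparse ord0 V f -> Q e) ->
  #|[set t in labelled_trees n.+1 | ~~ `[< Q (rel_of t) >]]| <=
  #|[set f : {ffun 'I_n.+1 -> 'I_n.+1} | sparse ord0 V f]|.
Proof.
move=> hQ; apply: leq_trans (leq_imset_card (@tree_code n.+1) _).
apply: subset_leq_card; apply/fintype.subsetP => t.
rewrite !inE => /andP[/asboolP tt nq].
have [f rf ef] := is_tree_parent ord0 tt.
have -> : t = tree_code f by apply/ffunP => -[x y]; rewrite ffunE -ef.
apply: imset_f; rewrite inE; apply: contraR nq => ns.
by apply/asboolP; exact: hQ ns.
Qed.

Lemma labelled_trees_gt0 n : 0 < #|labelled_trees n.+1|.
Proof.
apply: leq_trans (card_rooted_le n); apply/card_gt0P; exists [ffun=> ord0].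
rewrite inE; apply: (@rooted_of_depth _ _ _ (@nat_of_ord n.+1)) => [|x].
  by rewrite ffunE.
by rewrite ffunE lt0n.
Qed.

Local Open Scope ring_scope.

(** The failing trees inject into the sparse parent maps, and all parent maps
    inject into trees, so [card_sparse] bounds the proportion of failures. *)
Lemma tree_proportion_dist n : (4 * #|V| + 8 <= n)%N ->
  `|1 - tree_proportion R (fun n (e : rel 'I_n) => qaut_subgroup R P e) n| <=
  (6 * #|V| * 8 ^ #|V| * (4 * #|V|) ^ #|V|)%:R / n%:R.
Proof.
set C := (6 * _ * _ * _)%N; case: n => [|n] n0; first by rewrite addnS in n0.
rewrite /tree_proportion.
set good := [set t in labelled_trees n.+1 | _].
pose bad := [set t in labelled_trees n.+1 | ~~ `[< qaut_subgroup R P (rel_of t) >]].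
have Ngt0 : (0 : R) < #|labelled_trees n.+1|%:R by rewrite ltr0n labelled_trees_gt0.
have part : (#|good| + #|bad| = #|labelled_trees n.+1|)%N.
  rewrite -(cardsID good (labelled_trees _)).
  have gE t : (t \in good) = (t \in labelled_trees n.+1) &&
      `[< qaut_subgroup R P (rel_of t) >] by rewrite inE.
  have bE t : (t \in bad) = (t \in labelled_trees n.+1) &&
      ~~ `[< qaut_subgroup R P (rel_of t) >] by rewrite inE.
  congr (_ + _)%N; apply: eq_card => t.
    by rewrite finset.in_setI gE andbA andbb.
  by rewrite finset.in_setD gE bE; case: (t \in labelled_trees _); rewrite ?andbT ?andbF.
have badC : (n.+1 * #|bad| <= C * #|labelled_trees n.+1|)%N.
  have hk : (4 * #|V| + 8 <= #|'I_n.+1|)%N by rewrite card_ord.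
  have := card_sparse (ord0 : 'I_n.+1) hk; rewrite card_ord -/C => h.
  apply: leq_trans (leq_trans _ h) (leq_mul (leqnn _) (card_rooted_le n)).
  rewrite leq_mul // card_bad_trees_le // => f e.
  exact: qaut_subgroup_of_not_sparse.
have -> : 1 - #|good|%:R / #|labelled_trees n.+1|%:R = #|bad|%:R / #|labelled_trees n.+1|%:R :> R.
  by rewrite -part natrD in Ngt0 *; field; rewrite gt_eqF.
rewrite ger0_norm ?divr_ge0 ?ler0n // ler_pdivrMr // mulrAC ler_pdivlMr ?ltr0n //.
by move: badC; rewrite mulnC -(ler_nat R) !natrM.
Qed.

Lemma almost_all_trees_qaut_subgroup :
  almost_all_trees R (fun n (e : rel 'I_n) => qaut_subgroup R P e).
Proof.
pose C : R := (6 * #|V| * 8 ^ #|V| * (4 * #|V|) ^ #|V|)%:R.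
apply/cvgrPdist_le => eps e0; near=> n.
apply: le_trans (tree_proportion_dist _) _; first by near: n; exact: nbhs_infty_ge.
have n0 : (0 : R) < n%:R by rewrite ltr0n; near: n; exact: nbhs_infty_gt.
rewrite ler_pdivrMr // mulrC -ler_pdivrMr //.
near: n; exact: nbhs_infty_ger.
Unshelve. all: by end_near.
Qed.

End AlmostAll.

Theorem theorem4p1 (R : realType) (V : finType) (P : rel V) (treeP : is_tree P) :
  almost_all_trees R (fun (n : nat) (T : rel 'I_n) => qaut_subgroup R P T).
Proof. exact: almost_all_trees_qaut_subgroup. Qed.
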